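(* Let $G$ be a second countable, locally compact abelian Hausdorff group and let $\Gamma\subset G$ be a closed, countable, discrete subgroup with (compact) dual group $\widehat\Gamma$ and normalized Haar measure $\lambda$ on $\widehat\Gamma$. Let $\alpha:\Gamma\to\Gamma$ be an injective group endomorphism such that $\Gamma/\alpha(\Gamma)$ is finite with $N>1$ elements and such that the dual endomorphism $\alpha^{\ast}:\widehat\Gamma\to\widehat\Gamma$, $\alpha^{\ast}(\chi)=\chi\circ\alpha$, is ergodic with respect to $\lambda$. Let $\mathcal H$ be a separable Hilbert space, let $\pi:\Gamma\to\mathcal U(\mathcal H)$ be a unitary representation whose spectral measure $\mu$ on $\widehat\Gamma$ is absolutely continuous with respect to $\lambda$, and let $\delta:\mathcal H\to\mathcal H$ be a unitary operator with $$\delta^{-1}\pi(\gamma)\delta=\pi(\alpha(\gamma))\quad\text{for all }\gamma\in\Gamma .$$ Assume that for every $0\neq f\in L^2(G)$ the family of translates $\{T_\gamma f:\gamma\in\Gamma\}$, $T_\gamma f=f(\cdot-\gamma)$, is linearly independent. Suppose $0\neq\psi\in\mathcal H$. If the affine system $\{\delta^j\pi(\gamma)\psi:\ j\in\mathbb Z,\ \gamma\in\Gamma\}$ is a Parseval frame for $\mathcal H$, then it is linearly independent.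
   Context: A countable family $(f_n)$ in a Hilbert space $\mathcal H$ is a Parseval frame if $\sum_n|\langle f,f_n\rangle|^2=\|f\|^2$ for all $f\in\mathcal H$. A countable indexed family of vectors is linearly independent if every finite subfamily is linearly independent: a finite linear combination (over distinct indices) equal to $0$ has all coefficients $0$. Spectral measure of $\pi$: there are a finite Borel measure $\mu$ on $\widehat\Gamma$ (unique up to equivalence of measures), nested Borel subsets $\cdots\subset\sigma_2\subset\sigma_1\subset\widehat\Gamma$ (unique up to $\mu$-null sets), and a unitary operator $T:\mathcal H\to\bigoplus_i L^2(\sigma_i,\mu)$ with $[T(\pi(\gamma)f)]_i(\chi)=(\gamma,\chi)[Tf]_i(\chi)$ for all $i$, $\gamma\in\Gamma$, $f\in\mathcal H$ and $\mu$-a.e. $\chi$, where $(\gamma,\chi)$ denotes the value of the character $\chi$ at $\gamma$, and $T$ intertwines the projection valued measure of $\pi$ with multiplication by indicator functions of Borel sets. The sets $\sigma_i$ are understood so that $\mu$ is the maximal spectral type of $\pi$, i.e. $\mu(\widehat\Gamma\setminus\sigma_1)=0$. ''The spectral measure of $\pi$ is absolutely continuous'' refers to this $\mu$. *)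

(* Defs.v *)
From HB Require Import structures.
From mathcomp Require Import all_boot all_order all_algebra complex.
From mathcomp Require Import all_classical all_reals all_analysis.

Set Implicit Arguments.
Unset Strict Implicit.
Unset Printing Implicit Defensive.

Import Order.TTheory GRing.Theory Num.Def Num.Theory.
Import numFieldNormedType.Exports.

Local Open Scope classical_set_scope.
Local Open Scope ring_scope.

Definition discrete (T : topologicalType) := forall x : T, open [set x].

Lemma discrete_continuous (T U : topologicalType) (f : T -> U) :
  discrete T -> continuous f.
Proof.
move=> dT x A fA; apply: filterS (open_nbhs_nbhs (conj (dT x) erefl)).
by move=> y ->; exact: nbhs_singleton fA.
Qed.

Definition separable (T : topologicalType) :=
  exists2 D : set T, countable D & dense D.

(* A subgroup of G with the subspace topology; zmodClosed means closed under
   the group operations, not topologically closed. *)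
Section subgroup.
Variables (G : topologicalZmodType) (S : zmodClosed G).

Record subgrp := Subgrp { sgval :> G ; sgvalP : sgval \in S }.

HB.instance Definition _ := [isSub for sgval].
HB.instance Definition _ := [Choice of subgrp by <:].
HB.instance Definition _ := [SubChoice_isSubZmodule of subgrp by <:].
HB.instance Definition _ := Topological.copy subgrp (initial_topology sgval).

Let subgrp_sub_continuous :
  continuous (fun x : subgrp * subgrp => x.1 - x.2).
Proof.
apply/continuousP => _ [B oB <-].
have csg : continuous (sgval : subgrp -> G).
  exact: (@initial_continuous subgrp G sgval).
have cf : continuous (fun x : subgrp * subgrp => sgval x.1 - sgval x.2).
  move=> x; apply: (@continuous_comp _ _ _
    (fun x : subgrp * subgrp => (sgval x.1, sgval x.2))
    (fun x : G * G => x.1 - x.2)); last exact: sub_continuous.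
  apply: cvg_pair => /=.
  - by apply: (cvg_comp _ _ cvg_fst); exact: csg.
  - by apply: (cvg_comp _ _ cvg_snd); exact: csg.
by move/continuousP: cf => /(_ B oB).
Qed.

HB.instance Definition _ :=
  PreTopologicalNmodule_isTopologicalZmodule.Build subgrp
    subgrp_sub_continuous.

End subgroup.

(* The Pontryagin dual of A: continuous homomorphisms from A to the circle,
   with the compact-open topology. The group law is pointwise multiplication,
   written additively because abelian groups are zmodTypes. *)
Section dual.
Variables (R : realType) (A : topologicalZmodType).
Local Notation C := (R[i]^o).

Record dual := Character {
  chr :> A -> R[i] ;
  chr_continuous : continuous (chr : A -> C) ;
  chr_norm : forall a, `|chr a| = 1 ;
  chrD : forall a b, chr (a + b) = chr a * chr b }.

HB.instance Definition _ := gen_eqMixin dual.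
HB.instance Definition _ := gen_choiceMixin dual.

Lemma dual_eqP (x y : dual) : x =1 y -> x = y.
Proof.
case: x y => [x xc xn xD] [y yc yn yD] /= xy.
have {}xy : x = y by apply/funext.
by case: _ / xy yc yn yD => *; congr Character; exact: Prop_irrelevance.
Qed.

#[local] Obligation Tactic := idtac.

Program Definition dual0 : dual := @Character (fun=> 1) _ _ _.
Next Obligation. exact: cst_continuous. Qed.
Next Obligation. by move=> a; exact: normr1. Qed.
Next Obligation. by move=> a b /=; rewrite mulr1. Qed.

Let conj_cont : continuous (conjC : C -> C).
Proof.
move=> z P /= /(nbhs_ballP (conjC z : C))[e e0 eP].
apply/(nbhs_ballP (z : C)); exists e => // w zw; apply: eP.
by move: zw; rewrite /ball /= -rmorphB norm_conjC.
Qed.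

Program Definition dualN (x : dual) : dual :=
  @Character (fun a => conjC (x a)) _ _ _.
Next Obligation.
move=> x a; apply: (@continuous_comp A C C x conjC).
  exact: chr_continuous.
exact: conj_cont.
Qed.
Next Obligation. by move=> x a /=; rewrite norm_conjC chr_norm. Qed.
Next Obligation. by move=> x a b /=; rewrite chrD rmorphM. Qed.

Program Definition dualD (x y : dual) : dual :=
  @Character (fun a => x a * y a) _ _ _.
Next Obligation.
by move=> x y a; apply: (@cvgM R[i] A); exact: chr_continuous.
Qed.
Next Obligation. by move=> x y a /=; rewrite normrM !chr_norm mulr1. Qed.
Next Obligation. by move=> x y a b /=; rewrite !chrD mulrACA. Qed.

Let dualDA : associative dualD.
Proof. by move=> x y z; apply: dual_eqP => a /=; rewrite mulrA. Qed.
Let dualDC : commutative dualD.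
Proof. by move=> x y; apply: dual_eqP => a /=; rewrite mulrC. Qed.
Let dual0D : left_id dual0 dualD.
Proof. by move=> x; apply: dual_eqP => a /=; rewrite mul1r. Qed.
Let dualND : left_inverse dual0 dualN dualD.
Proof.
move=> x; apply: dual_eqP => a /=.
by rewrite mulrC -normCK chr_norm expr1n.
Qed.

HB.instance Definition _ :=
  GRing.isZmodule.Build dual dualDA dualDC dual0D dualND.

Definition dual_compact_open (x : dual) : {compact-open, A -> C} := chr x.

HB.instance Definition _ :=
  Topological.copy dual (initial_topology dual_compact_open).

Let dual_near (x : dual) (K : set A) (e : R[i]) : compact K -> 0 < e ->
  nbhs x [set y : dual | forall a, K a -> `|x a - y a| < e].
Proof.
move=> cK e0.
have xx : dual_compact_open y @[y --> x] --> dual_compact_open x.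
  exact: (@initial_continuous dual _ dual_compact_open).
have FF : Filter (dual_compact_open y @[y --> x]).
  exact: (@fmap_filter _ _ _ _ (nbhs_filter x)).
have := (compact_open_fam_compactP (@chr_continuous x) FF).1 xx.
move=> /(fam_cvgP _ _ FF) /(_ K cK).
move=> /(_ [set h | forall a, K a -> `|x a - h a| < e]); apply.
apply/uniform_nbhs; exists [set uv : C * C | `|uv.1 - uv.2| < e]; split => //.
rewrite -entourage_ballE; exists e => //=.
Qed.

Let dual_sub_continuous : continuous (fun x : dual * dual => x.1 - x.2).
Proof.
apply/continuousP => _ [B oB <-].
have cf : continuous
    (fun x : dual * dual => dual_compact_open (x.1 - x.2)).
  move=> [x y] /=.
  pose F : set_system (A -> C) :=
    dual_compact_open (z.1 - z.2) @[z --> (x, y)].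
  have FF : Filter F by exact: (@fmap_filter _ _ _ _ (nbhs_filter (x, y))).
  apply: (compact_open_fam_compactP (@chr_continuous (x - y)) FF).2.
  apply/(fam_cvgP _ _ FF) => K cK P /uniform_nbhs [E [+ EP]].
  rewrite -entourage_ballE => -[e /= e0 eE]; apply: filterS EP _; rewrite /F.
  have e20 : 0 < e / 2 by rewrite divr_gt0.
  exists ([set u : dual | forall a, K a -> `|x a - u a| < e / 2],
          [set u : dual | forall a, K a -> `|y a - u a| < e / 2]).
    by split => /=; exact: dual_near.
  move=> [u v] /= [xu yv] a Ka; apply: eE => /=.
  rewrite /ball /= (_ : _ - _ = (x a - u a) * conjC (y a)
    + u a * conjC (y a - v a)); last first.
    by rewrite rmorphB mulrBl mulrBr addrA subrK.
  rewrite (le_lt_trans (ler_normD _ _))// !normrM !norm_conjC !chr_norm.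
  by rewrite mulr1 mul1r [e]splitr ltrD// ?xu ?yv.
by move/continuousP: cf => /(_ B oB).
Qed.

HB.instance Definition _ :=
  PreTopologicalNmodule_isTopologicalZmodule.Build dual
    dual_sub_continuous.

End dual.

Program Definition dual_map (R : realType) (A B : topologicalZmodType)
    (f : {additive A -> B}) (cf : continuous f) (x : dual R B) : dual R A :=
  @Character R A (fun a => x (f a)) _ _ _.
Next Obligation.
move=> R A B f cf x a; apply: (@continuous_comp _ _ (R[i]^o) f x); first exact: cf.
exact: chr_continuous.
Qed.
Next Obligation. by move=> R A B f cf x a; rewrite chr_norm. Qed.
Next Obligation. by move=> R A B f cf x a b /=; rewrite raddfD chrD. Qed.


Definition borel (A : topologicalZmodType) :=
  @g_sigma_algebraType (A : zmodType) (@open A).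

(* Regularity is automatic when A is second countable. *)
Record haar_measure (R : realType) (A : topologicalZmodType)
    (m : {measure set (borel A) -> \bar R}) : Prop := HaarMeasure {
  haar_invariant : forall (a : A) (E : set A), measurable (E : set (borel A)) ->
    m [set a + x | x in E] = m E ;
  haar_compact : forall K : set A, compact K -> (m K < +oo)%E ;
  haar_open : forall U : set A, open U -> U !=set0 -> (0 < m U)%E }.

Record ergodic (R : realType) (d : measure_display) (X : measurableType d)
    (P : probability X R) (T : X -> X) : Prop := Ergodic {
  ergodic_measurable : measurable_fun setT T ;
  ergodic_preserving : forall E, measurable E -> P (T @^-1` E) = P E ;
  ergodic_invariant : forall E, measurable E -> T @^-1` E = E ->
    P E = 0%E \/ P E = 1%E }.

Definition sqnorm (R : realType) (V : normedModType R[i]) (v : V) : R :=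
  complex.Re (`|v| ^+ 2).

Section L2.
Variables (R : realType) (d : measure_display) (X : measurableType d).
Variable mu : {measure set X -> \bar R}.

Definition cmeasurable_fun (D : set X) (f : X -> R[i]) :=
  measurable_fun D (@complex.Re R \o f) /\ measurable_fun D (@complex.Im R \o f).

Definition sqint (D : set X) (f : X -> R[i]) : \bar R :=
  (\int[mu]_(x in D) (sqnorm (f x : R[i]^o))%:E)%E.

Definition L2 (D : set X) (f : X -> R[i]) :=
  cmeasurable_fun D f /\ (sqint D f < +oo)%E.

(* Elements of the Hilbert sum of the L^2(D i), as sequences of
   representatives. *)
Definition L2sum (D : nat -> set X) (g : nat -> X -> R[i]) :=
  (forall i, cmeasurable_fun (D i) (g i)) /\
  (\sum_(0 <= i <oo) sqint (D i) (g i) < +oo)%E.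

Definition L2sum_eq (D : nat -> set X) (g h : nat -> X -> R[i]) :=
  forall i, g i = h i %[ae mu in D i].

End L2.

(* Linear independence in L^2(G) of the translates of f, for a representative
   f: linear combinations are compared with 0 almost everywhere. *)
Definition independent_translates (R : realType) (G : topologicalZmodType)
    (S : zmodClosed G) (nu : {measure set (borel G) -> \bar R})
    (f : G -> R[i]) :=
  forall (s : seq (subgrp S)) (c : subgrp S -> R[i]), uniq s ->
    (fun x : G => \sum_(g <- s) c g * f (x - sgval g)) = (fun=> 0) %[ae nu] ->
    forall g, g \in s -> c g = 0.

Definition independent (K : nzRingType) (V : lmodType K) (I : eqType)
    (v : I -> V) :=
  forall (s : seq I) (c : I -> K), uniq s ->
    \sum_(i <- s) c i *: v i = 0 -> forall i, i \in s -> c i = 0.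

Section hilbert.
Variables (R : realType) (H : completeNormedModType R[i]).
Variable dot : {dot H for (@conjC R[i])}.

Definition hilbert := forall x, `|x| ^+ 2 = dot x x.

Record unitary := Unitary {
  uop :> {linear H -> H} ;
  uinv : H -> H ;
  uopK : cancel uop uinv ;
  uinvK : cancel uinv uop ;
  uop_dot : forall f g, dot (uop f) (uop g) = dot f g }.

Definition upow (U : unitary) (j : int) (f : H) : H :=
  match j with
  | Posz n => iter n U f
  | Negz n => iter n.+1 (uinv U) f
  end.

Definition parseval_frame (I : choiceType) (v : I -> H) :=
  countable [set: I] /\
  forall f, (\esum_(i in [set: I]) (sqnorm (dot f (v i) : R[i]^o))%:E
             = (sqnorm f)%:E)%E.

Variable A : topologicalZmodType.

(* Only used for discrete A, where no continuity of pi is required. *)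
Definition unitary_representation (pi : A -> unitary) :=
  forall a b f, pi (a + b) f = pi a (pi b f).

Local Notation X := (borel (dual R A)).

Record projection_valued_measure (P : set X -> H -> H) : Prop := PVM {
  pvm_linear : forall E, measurable E -> linear (P E) ;
  pvm_proj : forall E f, measurable E -> P E (P E f) = P E f ;
  pvm_sym : forall E f g, measurable E -> dot (P E f) g = dot f (P E g) ;
  pvmT : forall f, P setT f = f ;
  pvmI : forall E F f, measurable E -> measurable F ->
    P (E `&` F) f = P E (P F f) ;
  pvm_sigma_additive : forall (F : nat -> set X) f,
    (forall n, measurable (F n)) -> trivIset setT F ->
    \sum_(0 <= k < n) P (F k) f @[n --> \oo] --> P (\bigcup_n F n) f }.

(* pi a = \int (a, x) dP(x), in the weak sense. The diagonal matrix
   coefficients suffice by polarization. *)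
Definition pvm_of (pi : A -> unitary) (P : set X -> H -> H) :=
  projection_valued_measure P /\
  forall f, exists2 m : {finite_measure set X -> \bar R},
    forall E, measurable E -> m E = (complex.Re (dot (P E f) f))%:E &
    forall a, dot (pi a f) f =
      Complex (\int[m]_x complex.Re ((x : dual R A) a))%R
              (\int[m]_x complex.Im ((x : dual R A) a))%R.

(* T is a unitary operator from H onto the Hilbert sum of the
   L^2(sigma i, mu), given by representatives. The nested sets are numbered
   from 0, so sigma_full says that mu is the maximal spectral type. *)
Record spectral_data (pi : A -> unitary)
    (mu : {finite_measure set X -> \bar R}) (sigma : nat -> set X)
    (T : H -> nat -> X -> R[i]) (P : set X -> H -> H) : Prop := SpectralData {
  sigma_measurable : forall i, measurable (sigma i) ;
  sigma_nested : forall i, sigma i.+1 `<=` sigma i ;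
  sigma_full : mu (~` sigma 0%N) = 0%E ;
  spectral_L2 : forall f, L2sum mu sigma (T f) ;
  spectral_linear : forall (c : R[i]) f g,
    L2sum_eq mu sigma (T (c *: f + g)) (fun i x => c * T f i x + T g i x) ;
  spectral_isometry : forall f,
    (\sum_(0 <= i <oo) sqint mu (sigma i) (T f i) = (sqnorm f)%:E)%E ;
  spectral_onto : forall g, L2sum mu sigma g ->
    exists f, L2sum_eq mu sigma (T f) g ;
  spectral_rep : forall a f,
    L2sum_eq mu sigma (T (pi a f)) (fun i x => (x : dual R A) a * T f i x) ;
  spectral_pvm : pvm_of pi P ;
  spectral_indicator : forall E f, measurable E ->
    L2sum_eq mu sigma (T (P E f)) (fun i x => (\1_E x) * T f i x) }.

Definition spectral_measure (pi : A -> unitary)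
    (mu : {finite_measure set X -> \bar R}) :=
  exists sigma T P, spectral_data pi mu sigma T P.

End hilbert.

(* Main.v *)
Require Import Defs.
From HB Require Import structures.
From mathcomp Require Import all_boot all_order all_algebra complex.
From mathcomp Require Import all_classical all_reals all_analysis.
From mathcomp Require Import measurable_realfun.
From mathcomp Require Import zify ring lra.

Set Implicit Arguments.
Unset Strict Implicit.
Unset Printing Implicit Defensive.

Import Order.TTheory GRing.Theory Num.Def Num.Theory.
Import numFieldNormedType.Exports.

Local Open Scope complex_scope.
Local Open Scope classical_set_scope.
Local Open Scope ring_scope.

(* Write v_(j,g) = delta^j pi(g) psi and call j the level. Suppose a nontrivial
   finite combination of the v_(j,g) vanishes.

   Move one level of the relation to level 0 by a power of delta, and let f be
   such that every pi(a) f is orthogonal to the other levels of the relation.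
   Then u(a) = <psi, pi(a) f> is annihilated by convolution with a nonzero
   finitely supported sequence, and it is square summable by Bessel. If u were
   not 0, spreading it over the disjoint translates V + a of a small open set V
   of G would give a nonzero function of L^2(G) with dependent translates. So f
   is orthogonal to level 0.

   Applied to the top level of the relation, this shows that only 0 is
   orthogonal to all the levels j < 0: here the Parseval property is used to see
   that the orthogonal of these levels is invariant under pi. Applied to the
   bottom level, it shows that f is orthogonal to all the levels j < 0 as soon
   as it is orthogonal to the levels 0 <= j < J, where J is the width of the
   relation. So these J levels, which consist of finitely many, say m, orbits of
   pi, span a dense subspace; their frame operator S is an injective positive
   contraction commuting with pi.

   Approximating S^(-1/2) by functions t of S turns the generators g_1, ..., g_m
   of these orbits into vectors t g_i of norm at most 1 whose orbits form almost
   a Parseval frame. Since the orbits of the vectors delta^k psi, k >= 0, are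
   disjoint parts of the affine system, exchanging sums in
   sum_(k < K) sum_(i,g) |<delta^k psi, pi(g) t g_i>|^2
   bounds K |psi|^2 / 2 by m for all K, which is absurd. *)

(** * Auxiliary facts on sums and finite sequences *)

Lemma esum_subset (R : realType) (T : choiceType) (B C : set T)
    (a : T -> \bar R) :
  (forall x, 0 <= a x)%E -> B `<=` C ->
  (\esum_(x in B) a x <= \esum_(x in C) a x)%E.
Proof.
move=> a0 BC; rewrite (esumID B C) => [|x _]; last exact: a0.
by rewrite (setIidr BC) leeDl// esum_ge0.
Qed.

Lemma seq_argmax (T : eqType) (h : T -> int) (r : seq T) x : x \in r ->
  exists2 y, y \in r & forall z, z \in r -> h z <= h y.
Proof.
elim: r x => // y r IH x _.
have [->|[z zr]] : r = [::] \/ exists z, z \in r.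
    by case: r {IH} => [|z r]; [left|right; exists z; rewrite mem_head].
  by exists y; rewrite ?mem_head// => z; rewrite inE => /eqP ->.
have [w wr wmax] := IH z zr; have [wy|yw] := leP (h w) (h y).
  exists y; first exact: mem_head.
  by move=> v; rewrite inE => /orP[/eqP -> //|/wmax /le_trans]; apply.
exists w; first by rewrite inE wr orbT.
by move=> v; rewrite inE => /orP[/eqP ->|/wmax //]; exact: ltW.
Qed.

(** * The underlying real inner product *)

Section real_inner_product.
Variables (R : realType) (H : completeNormedModType R[i]).
Variable dot : {dot H for (@conjC R[i])}.
Hypothesis hilbertH : hilbert dot.

(** Norms and quadratic forms are compared in the ordered field [R] rather than in [R[i]], so the
    space is treated as a real one. *)
Definition rdot (f g : H) : R := complex.Re (dot f g).

Lemma dotC f g : dot f g = conjC (dot g f).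
Proof. by rewrite hermC expr0 mul1r. Qed.

Lemma rdotC f g : rdot f g = rdot g f.
Proof. by rewrite /rdot dotC; case: (dot g f). Qed.

Lemma rdotDl f g h : rdot (f + g) h = rdot f h + rdot g h.
Proof. by rewrite /rdot linearDl raddfD. Qed.

Lemma rdotDr f g h : rdot h (f + g) = rdot h f + rdot h g.
Proof. by rewrite !(rdotC h) rdotDl. Qed.

Lemma rdotNl f g : rdot (- f) g = - rdot f g.
Proof. by rewrite /rdot linearNl raddfN. Qed.

Lemma rdotBl f g h : rdot (f - g) h = rdot f h - rdot g h.
Proof. by rewrite rdotDl rdotNl. Qed.

Lemma rdotBr f g h : rdot h (f - g) = rdot h f - rdot h g.
Proof. by rewrite !(rdotC h) rdotBl. Qed.

Lemma rdotZl (a : R) f g : rdot (a%:C *: f) g = a * rdot f g.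
Proof.
rewrite /rdot linearZl_LR /=; case: (dot f g) => x y.
by rewrite /= mul0r subr0.
Qed.

Lemma rdotZr (a : R) f g : rdot f (a%:C *: g) = a * rdot f g.
Proof. by rewrite rdotC rdotZl rdotC. Qed.

Lemma rdot0l f : rdot 0 f = 0.
Proof. by rewrite /rdot linear0l raddf0. Qed.

Lemma dot_ge0 f : 0 <= dot f f.
Proof. by rewrite -hilbertH exprn_ge0. Qed.

Lemma dotff f : dot f f = (rdot f f)%:C.
Proof. by rewrite /rdot RRe_real// ger0_real// dot_ge0. Qed.

Lemma normH2 f : `|f| ^+ 2 = (rdot f f)%:C.
Proof. by rewrite hilbertH dotff. Qed.

Lemma rdot_ge0 f : 0 <= rdot f f.
Proof. by rewrite -lecR -normH2 exprn_ge0. Qed.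

Lemma rdot_eq0 f : rdot f f = 0 -> f = 0.
Proof.
by move=> f0; apply/normr0_eq0/eqP; rewrite -sqrf_eq0 normH2 f0.
Qed.

Lemma sqnormE f : sqnorm f = rdot f f.
Proof. by rewrite /sqnorm hilbertH. Qed.

Lemma rdot_CS f g : rdot f g ^+ 2 <= rdot f f * rdot g g.
Proof.
have [g0|g0] := eqVneq (rdot g g) 0.
  by rewrite (rdot_eq0 g0) rdotC !rdot0l expr0n mulr0.
have gg : 0 < rdot g g by rewrite lt_neqAle eq_sym g0 rdot_ge0.
have := rdot_ge0 ((rdot g g)%:C *: f - (rdot f g)%:C *: g).
rewrite rdotBl !rdotBr !rdotZl !rdotZr (rdotC g f).
set a := rdot f f; set b := rdot g g; set c := rdot f g.
rewrite [X in 0 <= X](_ : _ = b * (a * b - c ^+ 2)); last by ring.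
by rewrite pmulr_rge0// subr_ge0.
Qed.

Lemma rdot_inj f g : (forall h, rdot f h = rdot g h) -> f = g.
Proof.
move=> fg; apply/eqP; rewrite -subr_eq0; apply/eqP/rdot_eq0.
by rewrite rdotBl fg subrr.
Qed.

End real_inner_product.

(** * Norm convergence expressed by squared real distances *)

Section limits.
Variables (R : realType) (H : completeNormedModType R[i]).
Variable dot : {dot H for (@conjC R[i])}.
Hypothesis hilbertH : hilbert dot.
Local Notation rdot := (rdot dot).

Lemma normH_lt f (e : R) : 0 <= e -> (`|f| < e%:C) = (rdot f f < e ^+ 2).
Proof.
move=> e0; rewrite -ltcR -(normH2 hilbertH) rmorphXn /=.
by rewrite ltr_sqr ?nnegrE// ler0c.
Qed.

Lemma gt0_ReP (e : R[i]) : 0 < e -> e = (complex.Re e)%:C /\ 0 < complex.Re e.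
Proof. by case: e => a b; rewrite ltcE /= => /andP[/eqP -> ->]. Qed.

Lemma cvg_rdotP (x : nat -> H) (v : H) : x @ \oo --> v <->
  forall e : R, 0 < e ->
    exists N, forall n, (N <= n)%N -> rdot (v - x n) (v - x n) < e.
Proof.
split=> [/cvgrPdist_lt xv e e0|xv].
  have /xv [N _ xN] : 0 < (Num.sqrt e)%:C by rewrite ltcR sqrtr_gt0.
  exists N => n Nn; have := xN n Nn.
  by rewrite /= normH_lt ?sqrtr_ge0// sqr_sqrtr ?ltW.
apply/cvgrPdist_lt => e /gt0_ReP [-> e0].
have [N xN] := xv (complex.Re e ^+ 2) (exprn_gt0 _ e0).
by exists N => // n Nn /=; rewrite normH_lt ?xN// ltW.
Qed.

(** A Cauchy criterion: the increments of a convergent real sequence dominate the squared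
    distances. *)
Lemma cvg_of_increments (x : nat -> H) (b : nat -> R) : cvgn b ->
  (forall m n, (m <= n)%N -> rdot (x m - x n) (x m - x n) <= `|b m - b n|) ->
  cvgn x.
Proof.
move=> /cvg_ex [l bl] xb; apply/cauchy_cvgP/cauchy_exP => e /gt0_ReP [-> e0].
have e2 : 0 < complex.Re e ^+ 2 / 2 by rewrite divr_gt0// exprn_gt0.
move/cvgrPdist_lt : bl => /(_ _ e2) [N _ bN].
exists (x N); exists N => // n /= Nn.
rewrite -ball_normE /= normH_lt ?ltW//; apply: le_lt_trans (xb _ _ Nn) _.
have := bN N (leqnn N); have := bN n Nn; rewrite /=.
set a := b N; set c := b n ; rewrite !ltr_norml => /andP[c1 c2] /andP[a1 a2].
by apply/andP; split; lra.
Qed.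

Lemma cvg_rdotl (x : nat -> H) (v g : H) :
  x @ \oo --> v -> rdot (x n) g @[n --> \oo] --> rdot v g.
Proof.
move=> /cvg_rdotP xv; apply/cvgrPdist_lt => e e0 /=.
(* Adding 1 keeps the divisor positive when [g] is 0. *)
set s := rdot g g + 1.
have s0 : 0 < s by rewrite ltr_wpDl ?rdot_ge0.
have [N xN] := xv (e ^+ 2 / s) (divr_gt0 (exprn_gt0 _ e0) s0).
exists N => // n /= Nn.
rewrite -ltr_sqr ?nnegrE ?normr_ge0 ?ltW// real_normK ?num_real//.
rewrite -rdotBl; apply: le_lt_trans (rdot_CS hilbertH _ _) _.
apply: (@le_lt_trans _ _ (rdot (v - x n) (v - x n) * s)).
  by rewrite ler_wpM2l ?(rdot_ge0 hilbertH)// lerDl.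
by rewrite -ltr_pdivlMr// xN.
Qed.

End limits.

(** * Approximate inverse square roots of positive contractions *)

Section positive_contraction.
Variables (R : realType) (H : completeNormedModType R[i]).
Variable dot : {dot H for (@conjC R[i])}.
Hypothesis hilbertH : hilbert dot.
Local Notation rdot := (rdot dot).

Definition symmetric_op (X : H -> H) := forall f g, rdot (X f) g = rdot f (X g).

Definition pos_contraction (S : {linear H -> H}) :=
  [/\ symmetric_op S, forall f, 0 <= rdot (S f) f &
      forall f, rdot (S f) f <= rdot f f].

(** Polarization: expanding the forms at [f + g] recovers their values off the diagonal. *)
Lemma symmetric_op_eq (X Y : {linear H -> H}) :
  symmetric_op X -> symmetric_op Y ->
  (forall f, rdot (X f) f = rdot (Y f) f) -> X =1 Y.
Proof.
move=> sX sY XY f; apply: (rdot_inj hilbertH) => g.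
have := XY (f + g); rewrite !linearD !rdotDl !rdotDr !XY (sX g f) (sY g f).
by rewrite !(rdotC _ g); lra.
Qed.

(** The imaginary part of [dot h k] is the real part of [dot h ('i *: k)], so symmetry passes from
    [rdot] to [dot]. *)
Lemma symmetric_op_dot (X : {linear H -> H}) : symmetric_op X ->
  forall f g, dot (X f) g = dot f (X g).
Proof.
move=> sX f g.
have ImE h k : complex.Im (dot h k) = rdot h ('i%C *: k).
  rewrite /rdot linearZr_LR /=; case: (dot h k) => x y /=; ring.
apply/eqP; rewrite eq_complex; apply/andP; split; apply/eqP; first exact: sX.
by rewrite !ImE sX linearZ_LR.
Qed.

Variable S : {linear H -> H}.
Hypothesis pcS : pos_contraction S.

(** This is [S^2 <= S]: combine [0 <= S] at [f - S f] with [S <= 1] at [S f]. *)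
Lemma pos_contraction_sqr f : rdot (S f) (S f) <= rdot (S f) f.
Proof.
case: pcS => sS S0 S1.
have := S0 (f - S f); have := S1 (S f).
rewrite linearB rdotBl !rdotBr (sS (S f) f).
lra.
Qed.

Definition complement_op (f : H) := f - S f.

Lemma complement_op_linear : linear complement_op.
Proof.
move=> a f g; rewrite /complement_op linearP scalerBr opprD.
by rewrite addrACA.
Qed.
HB.instance Definition _ :=
  GRing.isLinear.Build R[i] H H *:%R complement_op complement_op_linear.

Local Notation A := complement_op.

Lemma complement_sym : symmetric_op A.
Proof.
by case: pcS => sS _ _ f g; rewrite rdotBl rdotBr sS.
Qed.

Lemma complement_norm f : rdot (A f) (A f) <= rdot f f - rdot (S f) f.
Proof.
have := pos_contraction_sqr f.
rewrite rdotBl !rdotBr (rdotC _ f (S f)); lra.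
Qed.

Lemma complement_contr f : rdot (A f) (A f) <= rdot f f.
Proof.
by case: pcS => _ S0 _; have := complement_norm f; have := S0 f; lra.
Qed.

Lemma complement_iter_sym n f g : rdot (iter n A f) g = rdot f (iter n A g).
Proof.
elim: n f g => //= n IH f g.
by rewrite complement_sym IH -iterSr.
Qed.

(** * Decay of the powers of [1 - S], and Newton iteration *)

Hypothesis S_inj : forall f, rdot (S f) f = 0 -> f = 0.

Lemma complement_iter_nincr f m n : (m <= n)%N ->
  rdot (iter n A f) (iter n A f) <= rdot (iter m A f) (iter m A f).
Proof.
move=> mn; rewrite -(subnK mn) iterD; elim: (n - m)%N => //= k IH.
exact: le_trans (complement_contr _) IH.
Qed.

(** The even powers [A^(2n) f] converge to some [v] with [A^2 v = v]. Applying [A] to [v] loses at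
    least [<S v, v>] of squared norm, so this form vanishes and [v = 0]. Monotonicity of the norms
    covers the odd powers. *)
Lemma complement_iter_cvg0 f (e : R) : 0 < e ->
  exists N, forall n, (N <= n)%N -> rdot (iter n A f) (iter n A f) <= e.
Proof.
move=> e0; pose b n := rdot (iter n A f) (iter n A f).
(* The inner product of two even powers depends only on [m + n], so squared distances are
   combinations of values of the monotone sequence [b]. *)
have bx m n : rdot (iter m.*2 A f) (iter n.*2 A f) = b (m + n)%N.
  rewrite -addnn iterD complement_iter_sym -iterD -addnn addnCA iterD.
  by rewrite -complement_iter_sym -iterD (addnC n m).
have b_ge0 n : 0 <= b n by exact: (rdot_ge0 hilbertH).
have b_cvg : cvgn b.
  apply: nonincreasing_is_cvgn => [m n mn|]; first exact: complement_iter_nincr.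
  by exists 0 => _ [n _ <-].
have b2_cvg : cvgn (fun n => b n.*2).
  move: b_cvg => /cvg_ex [l bl]; apply/cvg_ex; exists l.
  apply: cvg_comp bl => P [M _ MP]; exists M => // n /= Mn; apply: MP => /=.
  by rewrite -addnn (leq_trans Mn)// leq_addr.
have /cvg_ex [v xv] : cvgn (fun n => iter n.*2 A f).
  apply: (cvg_of_increments hilbertH b2_cvg) => m n mn.
  rewrite rdotBl !rdotBr !bx -!addnn (addnC n m).
  have bn1 : b (m + n)%N <= b (m + m)%N.
    by apply: complement_iter_nincr; rewrite leq_add2l.
  have bn2 : b (n + n)%N <= b (m + n)%N.
    by apply: complement_iter_nincr; rewrite leq_add2r.
  rewrite ger0_norm; lra.
have Av : A (A v) = v.
  apply/eqP; rewrite -subr_eq0; apply/eqP/(rdot_eq0 hilbertH).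
  apply/eqP; rewrite eq_le (rdot_ge0 hilbertH) andbT.
  have AAv : (fun n => A (A (iter n.*2 A f))) @ \oo --> A (A v).
    apply/(cvg_rdotP hilbertH) => d d0.
    have [N xN] := (cvg_rdotP hilbertH _ _).1 xv d d0.
    exists N => n Nn; rewrite -!linearB /=; apply: le_lt_trans (xN _ Nn).
    apply: le_trans (complement_contr _) _.
    exact: complement_contr.
  suff -> : A (A v) = v by rewrite subrr rdot0l.
  apply: cvg_unique AAv _; first exact: norm_hausdorff.
  move=> P /xv [M _ MP]; exists M => // n /= Mn.
  by apply: (MP n.+1); rewrite /= (leq_trans Mn).
have v0 : v = 0.
  apply: S_inj; apply/eqP; rewrite eq_le; case: pcS => _ -> _; rewrite andbT.
  have := complement_contr (A v); have := complement_norm v; rewrite Av; lra.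
have [N xN] := (cvg_rdotP hilbertH _ _).1 xv e e0.
exists N.*2 => n Nn; apply: le_trans (complement_iter_nincr f Nn) _.
have := xN N (leqnn N).
by rewrite v0 sub0r rdotNl rdotC rdotNl opprK => /ltW.
Qed.

(* The bicommutant of [S], so that any two such operators commute. *)
Definition function_of (X : {linear H -> H}) :=
  symmetric_op X /\
  forall Y : {linear H -> H}, (forall f, Y (S f) = S (Y f)) ->
    forall f, Y (X f) = X (Y f).

(** The polynomial identity [1 - (1 - G)(1 + G/2)^2 = 3/4 G^2 + 1/4 G^3]. *)
Lemma newton_identity (G : {linear H -> H}) f (w := f + (2^-1)%:C *: G f) :
  f - (w - G w + (2^-1)%:C *: G (w - G w)) =
  (3 / 4)%:C *: G (G f) + (4^-1)%:C *: G (G (G f)).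
Proof.
apply: (rdot_inj hilbertH) => h; rewrite /w.
rewrite !(linearN G, linearD G, linearZ_LR G) /=.
by rewrite !(rdotDl, rdotNl, rdotZl); lra.
Qed.

(** For [t] commuting with [S] this is [1 - S t^2], the defect of [t] as an inverse square root of
    [S]. *)
Definition residual (t : {linear H -> H}) (f : H) := f - t (S (t f)).

Lemma residual_linear t : linear (residual t).
Proof.
move=> a f g; rewrite /residual (linearP t a f g) (linearP S) (linearP t).
by rewrite scalerBr opprD addrACA.
Qed.
HB.instance Definition _ t :=
  GRing.isLinear.Build R[i] H H *:%R (residual t) (residual_linear t).

Section newton_step.
Variable t : {linear H -> H}.
Hypothesis ft : function_of t.

Local Notation F := (residual t).

Lemma residual_sym : symmetric_op F.
Proof.
case: ft => st _ f g; case: pcS => sS _ _.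
by rewrite rdotBl rdotBr st sS st.
Qed.

Lemma residual_commute (Y : {linear H -> H}) :
  (forall f, Y (S f) = S (Y f)) -> forall f, Y (F f) = F (Y f).
Proof.
by move=> YS f; rewrite /residual linearB (ft.2 Y YS) YS (ft.2 Y YS).
Qed.

(* With [x = S], this is the Newton iteration [y |-> y (3 - x y^2) / 2] for
   [x^(-1/2)]: the residual [1 - x y^2] decreases quadratically. *)
Definition newton_step (f : H) := t (f + (2^-1)%:C *: F f).

Lemma newton_step_linear : linear newton_step.
Proof.
move=> a f g; rewrite /newton_step -linearP; congr (t _).
rewrite (linearP F) (scalerDr (2^-1)%:C) (scalerDr a) !scalerA.
by rewrite [_%:C * a]mulrC addrACA.
Qed.
HB.instance Definition _ :=
  GRing.isLinear.Build R[i] H H *:%R newton_step newton_step_linear.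

Lemma newton_stepE f : newton_step f = t f + (2^-1)%:C *: t (F f).
Proof. by rewrite /newton_step (linearD t) (linearZ_LR t). Qed.

Let tF f : t (F f) = F (t f).
Proof. by apply: residual_commute => g; rewrite (ft.2 S). Qed.

Lemma function_of_newton_step : function_of newton_step.
Proof.
split=> [f g|Y YS f] /=; rewrite !newton_stepE.
  by rewrite rdotDl rdotDr rdotZl rdotZr tF residual_sym !ft.1.
by rewrite (linearD Y) (linearZ_LR Y) /= !(ft.2 Y YS) (residual_commute YS).
Qed.

Lemma residual_newton_step f : residual newton_step f =
  (3 / 4)%:C *: F (F f) + (4^-1)%:C *: F (F (F f)).
Proof.
have tStE h : t (S (t h)) = h - F h by rewrite /residual opprB addrC subrK.
pose w := f + (2^-1)%:C *: F f.
rewrite {1}/residual /= (_ : newton_step f = t w)// newton_stepE tF tStE /w.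
exact: newton_identity.
Qed.

End newton_step.

(** The identity has residual [A]. Each step turns a residual [F] into [3/4 F^2 + 1/4 F^3], which
    stays positive, and doubles the power of [A] that bounds it. *)
Lemma newton_iteration n : exists t : {linear H -> H},
  [/\ function_of t, forall f, 0 <= rdot (residual t f) f &
      forall f, rdot (residual t f) (residual t f) <=
        rdot (iter (2 ^ n) A f) (iter (2 ^ n) A f)].
Proof.
elim: n => [|n [t [ft t0 tA]]].
  exists idfun; split=> [|f|f] /=; first by split.
    by rewrite rdotBl subr_ge0; case: pcS => _ _ ->.
  exact: lexx.
exists (newton_step t); split=> [|f|f].
- exact: function_of_newton_step.
- rewrite (residual_newton_step ft) rdotDl !rdotZl.
  rewrite residual_sym// (residual_sym ft (residual t (residual t f))).
  by rewrite addr_ge0// mulr_ge0// (rdot_ge0 hilbertH).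
rewrite (residual_newton_step ft).
set b := residual t (residual t f).
have bA : rdot b b <= rdot (iter (2 ^ n.+1) A f) (iter (2 ^ n.+1) A f).
  rewrite expnS mul2n -addnn iterD; apply: le_trans (tA _) _.
  (* The residual commutes with [A], so its bound can be applied twice in a row. *)
  suff AF k h : iter k A (residual t h) = residual t (iter k A h).
    by rewrite AF; exact: tA.
  elim: k => //= k ->; apply: (residual_commute ft) => g /=.
  by rewrite /complement_op (linearB S).
have Fb : rdot (residual t b) (residual t b) <= rdot b b.
  by apply: le_trans (tA _) _; exact: (complement_iter_nincr b (leq0n _)).
apply: le_trans bA; move: Fb; move: (residual t b) => c; clearbody b => cb.
(* Convexity: [3/4 b + 1/4 c] is no longer than [b], since [c] is not. *)
have := rdot_ge0 hilbertH (b - c).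
rewrite rdotBl !rdotBr !(rdotDl, rdotDr, rdotZl, rdotZr) (rdotC _ c b).
by lra.
Qed.

(** With [F] the residual of a Newton iterate [t], [<S t f, t f> = |f|^2 - <F f, f>]. Positivity of
    [F] gives the upper bound; Cauchy-Schwarz and the decay of the powers of [A] give the lower
    one. *)
Lemma inverse_sqrt (r : seq H) (e : R) : 0 < e -> exists t : {linear H -> H},
  [/\ function_of t, forall f, rdot (S (t f)) (t f) <= rdot f f &
      forall h, h \in r -> rdot h h - e <= rdot (S (t h)) (t h)].
Proof.
move=> e0.
(* One [n] serves the whole list because the norms of the powers decrease. *)
have [n rn] : exists n, forall h, h \in r ->
    rdot (iter (2 ^ n) A h) (iter (2 ^ n) A h) * rdot h h <= e ^+ 2.
  elim: r => [|h r [n rn]]; first by exists 0%N.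
  have d0 : 0 < e ^+ 2 / (rdot h h + 1).
    by rewrite divr_gt0 ?exprn_gt0// ltr_wpDl ?(rdot_ge0 hilbertH).
  have [m hm] := complement_iter_cvg0 h d0.
  exists (maxn m n) => g; rewrite inE => /orP[/eqP ->|gr].
    have {}hm : rdot (iter (2 ^ maxn m n) A h) (iter (2 ^ maxn m n) A h) <=
        e ^+ 2 / (rdot h h + 1).
      apply: hm; apply: leq_trans (leq_maxl m n) _.
      exact: ltnW (ltn_expl _ _).
    apply: (@le_trans _ _ (e ^+ 2 / (rdot h h + 1) * (rdot h h + 1))).
      rewrite ler_pM ?(rdot_ge0 hilbertH)// ?(rdot_ge0 hilbertH)//.
      by rewrite lerDl.
    by rewrite divfK// gt_eqF// ltr_wpDl ?(rdot_ge0 hilbertH).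
  apply: le_trans (rn _ gr); rewrite ler_wpM2r ?(rdot_ge0 hilbertH)//.
  by apply: complement_iter_nincr; rewrite leq_exp2l// leq_maxr.
have [t [ft t0 tA]] := newton_iteration n.
have tE f : rdot (S (t f)) (t f) = rdot f f - rdot (residual t f) f.
  by rewrite rdotBl opprB addrC subrK ft.1.
exists t; split=> // [f|h hr].
  by rewrite tE; have := t0 f; lra.
rewrite tE lerD2l lerN2.
apply: le_trans (ler_norm _) _.
rewrite -ler_sqr ?nnegrE ?normr_ge0 ?(ltW e0)// real_normK ?num_real//.
apply: le_trans (rdot_CS hilbertH _ _) _; apply: le_trans (rn h hr).
by rewrite ler_wpM2r ?(rdot_ge0 hilbertH).
Qed.

End positive_contraction.

(** * Frame operators *)

Section frame_operator.
Variables (R : realType) (H : completeNormedModType R[i]).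
Variable dot : {dot H for (@conjC R[i])}.
Hypothesis hilbertH : hilbert dot.
Local Notation rdot := (rdot dot).

Definition coef2 (f g : H) : R := sqnorm (dot f g : R[i]^o).

Lemma coef2_ge0 f g : 0 <= coef2 f g.
Proof.
by rewrite /coef2 /sqnorm -lecR RRe_real ?exprn_ge0// ger0_real ?exprn_ge0.
Qed.

Lemma coef2_eq0 f g : coef2 f g = 0 -> dot f g = 0.
Proof.
rewrite /coef2 /sqnorm => fg0; apply/normr0_eq0/eqP; rewrite -sqrf_eq0.
by rewrite -[_ ^+ 2]RRe_real ?fg0// ger0_real ?exprn_ge0.
Qed.

Lemma coef2C f g : coef2 f g = coef2 g f.
Proof. by rewrite /coef2 dotC /sqnorm norm_conjC. Qed.

Lemma coef2ff f : coef2 f f = rdot f f ^+ 2.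
Proof.
rewrite /coef2 /sqnorm dotff.
by rewrite ger0_norm ?ler0c ?(rdot_ge0 hilbertH)// -rmorphXn.
Qed.

Lemma coef20l f : coef2 0 f = 0.
Proof. by rewrite /coef2 linear0l /sqnorm normr0 expr0n. Qed.

Lemma coef20r f : coef2 f 0 = 0.
Proof. by rewrite coef2C coef20l. Qed.

Section partial_sums.
Variable w : nat -> H.
Hypothesis bessel : forall f n, \sum_(k < n) coef2 f (w k) <= rdot f f.

(** A block of the series of the frame operator; the lower bound [m] serves the Cauchy estimate. *)
Definition frame_sum m n (f : H) : H := \sum_(m <= k < n) dot f (w k) *: w k.

Lemma frame_sum_linear m n : linear (frame_sum m n).
Proof.
move=> a f g; rewrite /frame_sum scaler_sumr -big_split /=.
apply: eq_bigr => k _; rewrite linearDl linearZl_LR /= scalerDl.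
by rewrite scalerA.
Qed.
HB.instance Definition _ m n :=
  GRing.isLinear.Build R[i] H H *:%R (frame_sum m n) (frame_sum_linear m n).

Lemma rdot_frame_sum m n f : rdot (frame_sum m n f) f =
  \sum_(m <= k < n) coef2 f (w k).
Proof.
rewrite /rdot /frame_sum linear_sumlz raddf_sum; apply: eq_bigr => k _ /=.
rewrite linearZl_LR /= (dotC dot (w k) f).
by rewrite /coef2 /sqnorm -normCK.
Qed.

Lemma frame_sum_sym m n : symmetric_op dot (frame_sum m n).
Proof.
move=> f g; rewrite [RHS]rdotC.
rewrite /rdot /frame_sum !linear_sumlz !raddf_sum; apply: eq_bigr => k _ /=.
rewrite !linearZl_LR /= (dotC dot (w k) f) (dotC dot (w k) g).
by case: (dot f _) => a b; case: (dot g _) => c d; rewrite /=; ring.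
Qed.

Lemma frame_sum_pos_contraction m n : pos_contraction dot (frame_sum m n).
Proof.
split=> [|f|f]; first exact: frame_sum_sym.
  by rewrite rdot_frame_sum sumr_ge0// => k _; exact: coef2_ge0.
rewrite rdot_frame_sum; apply: le_trans (bessel f n).
have [mn|nm] := leqP m n; last first.
  by rewrite big_geq ?(ltnW nm)// sumr_ge0// => k _; exact: coef2_ge0.
rewrite -(big_mkord xpredT (fun k => coef2 f (w k))).
rewrite (big_cat_nat (leq0n m) mn)//=.
by rewrite lerDr sumr_ge0// => k _; exact: coef2_ge0.
Qed.

(** Each block is a positive contraction, so its squared norm at [f] is at most its form at [f], a
    block of the bounded Bessel sums. *)
Lemma frame_sum_cvg f : cvgn (fun n => frame_sum 0 n f).
Proof.
pose b n := \sum_(0 <= k < n) coef2 f (w k).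
have b_le m n : (m <= n)%N -> b n - b m = \sum_(m <= k < n) coef2 f (w k).
  by move=> mn; rewrite /b (big_cat_nat (leq0n m) mn)//= addrAC subrr add0r.
apply: (cvg_of_increments hilbertH (b := b)).
  apply: nondecreasing_is_cvgn => [m n mn|].
    by rewrite -subr_ge0 b_le// sumr_ge0// => k _; exact: coef2_ge0.
  exists (rdot f f) => _ [n _ <-]; rewrite /b big_mkord; exact: bessel.
move=> m n mn.
have -> : frame_sum 0 m f - frame_sum 0 n f = - frame_sum m n f.
  rewrite /frame_sum [in X in _ - X](big_cat_nat (leq0n m) mn)//=.
  by rewrite opprD addNKr.
rewrite rdotNl rdotC rdotNl opprK distrC b_le//.
apply: le_trans (pos_contraction_sqr (frame_sum_pos_contraction m n) f) _.
by rewrite rdot_frame_sum ler_norm.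
Qed.

Lemma frame_operator_seq : exists2 S : {linear H -> H}, symmetric_op dot S &
  forall f, \sum_(k < n) coef2 f (w k) @[n --> \oo] --> rdot (S f) f.
Proof.
pose S f := lim (frame_sum 0 n f @[n --> \oo]).
have cS f : frame_sum 0 n f @[n --> \oo] --> S f by exact: frame_sum_cvg.
have lS : linear S.
  move=> a f g; apply/cvg_lim; first exact: norm_hausdorff.
  rewrite (_ : (fun n => _) =
      (fun n => a *: frame_sum 0 n f + frame_sum 0 n g)); last first.
    by apply/funext => n; rewrite linearP.
  by apply: cvgD => //; exact: cvgZr.
pose lSm := GRing.isLinear.Build R[i] H H *:%R S lS.
pose SL : {linear H -> H} := HB.pack S lSm.
exists SL => [f g|f] /=.
  transitivity (limn (fun n => rdot (frame_sum 0 n f) g)).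
    by apply/esym/cvg_lim => //; exact: cvg_rdotl.
  apply/cvg_lim => //.
  rewrite (_ : (fun n => _) = (fun n => rdot (frame_sum 0 n g) f)); last first.
    by apply/funext => n; rewrite rdotC frame_sum_sym.
  by rewrite /= (rdotC _ f); exact: cvg_rdotl.
rewrite (_ : (fun n => _) = (fun n => rdot (frame_sum 0 n f) f)); last first.
  by apply/funext => n; rewrite rdot_frame_sum big_mkord.
exact: cvg_rdotl.
Qed.

End partial_sums.

Lemma frame_operator (I : choiceType) (D : set I) (v : I -> H) : countable D ->
  (forall f, (\esum_(i in D) (coef2 f (v i))%:E <= (rdot f f)%:E)%E) ->
  exists2 S : {linear H -> H}, symmetric_op dot S &
    forall f, (\esum_(i in D) (coef2 f (v i))%:E = (rdot (S f) f)%:E)%E.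
Proof.
move=> /countable_injP [e e_inj] bessel.
pose w n := if pselect (exists2 i, D i & e i = n) is left h
            then v (projT1 (cid2 h)) else 0.
have wE i : D i -> w (e i) = v i.
  move=> Di; rewrite /w; case: pselect => [h|]; last by case; exists i.
  case: cid2 => j /= Dj eji; congr v; apply: e_inj; rewrite ?inE//.
have w0 n : ~ (e @` D) n -> w n = 0.
  by rewrite /w; case: pselect => // h [].
have esumE f : (\esum_(i in D) (coef2 f (v i))%:E =
                \sum_(0 <= n <oo) (coef2 f (w n))%:E)%E.
  rewrite nneseries_esumT => [|n]; last by rewrite lee_fin coef2_ge0.
  rewrite (esumID (e @` D)) => [|n _]; last by rewrite lee_fin coef2_ge0.
  rewrite !setTI [X in (_ + X)%E]esum1 ?adde0; last first.
    by move=> n /w0 ->; rewrite coef20r.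
  rewrite esum_image//; apply: eq_esum => i Di; by rewrite wE.
have [n f|S sS SE] := @frame_operator_seq w.
  rewrite -lee_fin; apply: le_trans (bessel n); rewrite esumE -sumEFin.
  rewrite -(big_mkord xpredT (fun k => (coef2 n (w k))%:E)).
  by apply: nneseries_lim_ge => k _; rewrite lee_fin coef2_ge0.
exists S => // f; rewrite esumE; apply/cvg_lim => //.
rewrite (_ : (fun n => _) = EFin \o (fun n => \sum_(k < n) coef2 f (w k))).
  by apply/fine_cvgP; split; [exact: nearW|exact: SE].
by apply/funext => n /=; rewrite big_mkord sumEFin.
Qed.

End frame_operator.

(** * Convolution on a discrete subgroup *)

Section small_neighborhood.
Variables (G : topologicalZmodType) (Gamma : zmodClosed G).
Hypothesis locally_compactG : locally_compact [set: G].
Hypothesis discreteGamma : discrete (subgrp Gamma).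

Lemma sgval0 : sgval (0 : subgrp Gamma) = 0.
Proof. exact: (raddf0 (\val : subgrp Gamma -> G)). Qed.

Lemma sgvalD (a b : subgrp Gamma) : sgval (a + b) = sgval a + sgval b.
Proof. exact: (raddfD (\val : subgrp Gamma -> G)). Qed.

Lemma sgvalB (a b : subgrp Gamma) : sgval (a - b) = sgval a - sgval b.
Proof. exact: (raddfB (\val : subgrp Gamma -> G)). Qed.

(** Continuity of subtraction gives a [V] whose differences meet [Gamma] only in 0, so its
    translates by [Gamma] are disjoint. The compact [K] makes its Haar measure finite. *)
Lemma small_open_neighborhood : exists V : set G,
  [/\ open V, V 0, (exists K, [/\ compact K, closed K & V `<=` K]) &
      forall (x : G) (a b : subgrp Gamma),
        V (x - sgval a) -> V (x - sgval b) -> a = b].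
Proof.
have [B oB B0] : open [set (0 : subgrp Gamma)] by exact: discreteGamma.
have B0' : B 0.
  rewrite -sgval0; change ((@sgval G Gamma @^-1` B) 0).
  by rewrite B0.
have [K K0 [cK clK]] : compact_near (within [set: G] (nbhs (0 : G))).
  exact: locally_compactG.
rewrite withinET in K0.
have /= : nbhs (0 : G, 0 : G) ((fun x : G * G => x.1 - x.2) @^-1` B).
  apply: (@sub_continuous G (0, 0)).
  by rewrite /= subr0; exact: open_nbhs_nbhs.
move=> [[U W] /= [U0 W0] UWB].
have : nbhs (0 : G) (U `&` W `&` K) by apply: filterI => //; exact: filterI.
rewrite nbhsE => -[V [oV V0] VUWK]; exists V; split=> //.
  by exists K; split=> // x /VUWK [].
move=> x a b /VUWK [[_ Wa] _] /VUWK [[Ub _] _].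
have : B (sgval (a - b)).
  rewrite sgvalB; have := UWB (x - sgval b, x - sgval a) (conj Ub Wa).
  by rewrite /= opprB addrC addrA subrK.
change ((@sgval G Gamma @^-1` B) (a - b) -> a = b).
by rewrite B0 => /eqP; rewrite subr_eq0 => /eqP.
Qed.

End small_neighborhood.

(** * Step functions on disjoint translates of an open set *)

Section convolution.
Variables (R : realType) (G : topologicalZmodType).
Variable nu : {measure set (borel G) -> \bar R}.
Hypothesis haar_nu : haar_measure nu.
Variable Gamma : zmodClosed G.
Variable V : set G.
Hypotheses (oV : open V) (V_fin : (nu V < +oo)%E).
Hypothesis V_disj : forall (x : G) (a b : subgrp Gamma),
  V (x - sgval a) -> V (x - sgval b) -> a = b.

Definition translate (a : G) : set (borel G) := [set x : G | V (x - a)].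

Lemma open_translate a : open (translate a : set G).
Proof.
have ca : continuous (fun x : G => x - a).
  move=> x; apply: (@continuous_comp _ _ _ (fun x : G => (x, a))
    (fun x : G * G => x.1 - x.2)); last exact: sub_continuous.
  by apply: cvg_pair => /=; [exact: cvg_id|exact: cvg_cst].
by move/continuousP: ca => /(_ V oV).
Qed.

Lemma open_borel (U : set G) : open U -> measurable (U : set (borel G)).
Proof. by move=> oU; exact: sub_sigma_algebra. Qed.

Lemma closed_borel (C : set G) : closed C -> measurable (C : set (borel G)).
Proof.
move=> cC; rewrite -[C]setCK; apply: measurableC; apply: open_borel.
exact: closed_openC.
Qed.

Lemma measurable_translate a : measurable (translate a).
Proof. apply: (@open_borel (translate a)); exact: open_translate. Qed.

Lemma translate_measure a : nu (translate a) = nu V.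
Proof.
rewrite -(haar_invariant haar_nu a (open_borel oV)); congr (nu _).
apply/seteqP; split=> [x /= Vx|_ [x Vx <-]]; last first.
  by rewrite /translate /= addrC addKr.
by exists (x - a) => //; rewrite addrC subrK.
Qed.

Variable u : subgrp Gamma -> R[i].

(** The step function with value [u a] on [V + a]; disjointness makes the chosen index unique. *)
Definition spread (x : G) : R[i] :=
  if pselect (exists a, V (x - sgval a)) is left h
  then u (projT1 (cid h)) else 0.

Lemma spreadE x a : V (x - sgval a) -> spread x = u a.
Proof.
move=> Va; rewrite /spread; case: pselect => [h|]; last by case; exists a.
by case: cid => b /= Vb; congr u; exact: V_disj Vb Va.
Qed.

Lemma spread0 x : (forall a : subgrp Gamma, ~ V (x - sgval a)) -> spread x = 0.
Proof.
by move=> Va; rewrite /spread; case: pselect => // h; have [a /Va] := h.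
Qed.

(** No condition on [Q] is imposed: the set is a union of open translates, joined by the complement
    of all translates when [Q 0] holds. *)
Lemma spread_measurable (Q : R[i] -> Prop) :
  measurable ([set x | Q (spread x)] : set (borel G)).
Proof.
pose O (P : subgrp Gamma -> Prop) := \bigcup_(a in P) translate (sgval a).
have mO P : measurable (O P).
  by apply: open_borel; apply: bigcup_open => a _; exact: open_translate.
have [Q0|Q0] := pselect (Q 0).
  rewrite (_ : [set x | _] = O (fun a => Q (u a)) `|` ~` O setT).
    by apply: measurableU => //; exact: measurableC.
  apply/seteqP; split=> x /=; last first.
    case=> [[a Qa Va]|nO]; first by rewrite (spreadE Va).
    by rewrite spread0// => a Va; apply: nO; exists a.
  have [[a Va]|nVa] := pselect (exists a : subgrp Gamma, V (x - sgval a)).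
    by rewrite (spreadE Va) => Qa; left; exists a.
  by move=> _; right => -[a _ Va]; apply: nVa; exists a.
rewrite (_ : [set x | _] = O (fun a => Q (u a)))//.
apply/seteqP; split=> x /=; last first.
  by case=> a Qa Va; rewrite (spreadE Va).
have [[a Va]|nVa] := pselect (exists a : subgrp Gamma, V (x - sgval a)).
  by rewrite (spreadE Va) => Qa; exists a.
by rewrite spread0// => a Va; apply: nVa; exists a.
Qed.

Lemma spread_measurable_fun (d : measure_display) (T : measurableType d)
    (h : R[i] -> T) : measurable_fun [set: borel G] (h \o spread).
Proof.
move=> _ Y mY; rewrite setTI.
exact: (spread_measurable (fun z => Y (h z))).
Qed.

Hypothesis countableGamma : countable [set: subgrp Gamma].
Hypothesis u_l2 :
  (\esum_(a in [set: subgrp Gamma]) (sqnorm (u a : R[i]^o))%:E < +oo)%E.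

(** The translate [V + a] contributes [nu V * |u a|^2], and these terms have a finite sum. *)
Lemma spread_L2 : L2 nu setT spread.
Proof.
split; first by split; exact: spread_measurable_fun.
have nuV : nu V \is a fin_num by rewrite ge0_fin_numE.
have [e e_inj] := countable_injP _ countableGamma.
pose q z : R := sqnorm (z : R[i]^o).
have q_ge0 z : 0 <= q z.
  by rewrite /q /sqnorm -lecR RRe_real ?exprn_ge0// ger0_real ?exprn_ge0.
have q0 : q 0 = 0 by rewrite /q /sqnorm normr0 expr0n.
have mq : measurable_fun [set: borel G] (fun x : borel G => (q (spread x))%:E).
  exact: (spread_measurable_fun (EFin \o q)).
(* The translates are indexed by [nat] through [e]; [F n] is empty when [n] is not a value of
   [e]. *)
pose F n : set (borel G) :=
  \bigcup_(a in [set a | e a = n]) translate (sgval a).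
have mF n : measurable (F n).
  by apply: open_borel; apply: bigcup_open => a _; exact: open_translate.
have F_disj : trivIset setT F.
  move=> m n _ _ [x [[a <- Va] [b <- Vb]]].
  by congr e; exact: V_disj Va Vb.
pose D := \bigcup_n F n.
have mD : measurable D by exact: bigcupT_measurable.
have F_int n : (\int[nu]_(x in F n) (q (spread x))%:E <=
   nu V * \esum_(a in [set a | e a = n]) (q (u a))%:E)%E.
  have [[a ean]|nan] := pselect (exists a, e a = n); last first.
    rewrite (_ : F n = set0) ?integral_set0.
      by rewrite mule_ge0// esum_ge0// => a _; rewrite lee_fin.
    by apply/seteqP; split=> // x [a ean _]; apply: nan; exists a.
  rewrite (_ : [set a | e a = n] = [set a]); last first.
    apply/seteqP; split=> [b /= ebn|_ ->]//; apply: e_inj; rewrite ?inE//.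
    by rewrite ebn.
  rewrite esum_set1 ?lee_fin//.
  rewrite (_ : F n = translate (sgval a)); last first.
    apply/seteqP; split=> [x [b ebn Vb]|x Vx]; last by exists a.
    suff -> : a = b by [].
    by apply: e_inj; rewrite ?inE// ebn.
  rewrite (eq_integral (cst (q (u a))%:E)); last first.
    by move=> x; rewrite inE => Vx; rewrite (spreadE Vx).
  by rewrite (integral_cst nu (measurable_translate _)) translate_measure muleC.
rewrite /sqint -/q.
rewrite (_ : (\int[nu]_(x in setT) _)%E =
             (\int[nu]_(x in D) (q (spread x))%:E)%E); last first.
  rewrite [in RHS]integral_mkcond; apply: eq_integral => x _.
  rewrite patchE; case: ifPn => //; rewrite notin_setE => nD.
  rewrite spread0 => [|a Va]; first by rewrite -/(q 0) q0.
  by apply: nD; exists (e a) => //; exists a.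
rewrite ge0_integral_bigcup//; last 2 first.
  exact: measurable_funTS.
  by move=> x _; rewrite lee_fin.
apply: (@le_lt_trans _ _
    (nu V * \esum_(a in [set: subgrp Gamma]) (q (u a))%:E)%E).
  rewrite (_ : [set: subgrp Gamma] = \bigcup_n [set a | e a = n]); last first.
    by apply/seteqP; split=> // a _; exists (e a).
  rewrite esum_bigcupT//; last 2 first.
    by move=> m n _ _ [a [/= <- <-]].
    by move=> a; rewrite lee_fin.
  rewrite -nneseries_esumT; last first.
    by move=> n; apply: esum_ge0 => a _; rewrite lee_fin.
  rewrite -[X in (X * _)%E](fineK nuV) -nneseriesZl => [|n _]; last first.
    by apply: esum_ge0 => a _; rewrite lee_fin.
  apply: lee_nneseries => n _; last by rewrite fineK.
  by rewrite integral_ge0// => x _; rewrite lee_fin.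
by rewrite lte_mul_pinfty.
Qed.

End convolution.
(** Otherwise [spread V u] would be a nonzero function of L^2(G) with dependent translates. *)
Lemma l2_convolution_injective (R : realType) (G : topologicalZmodType)
    (locally_compactG : locally_compact [set: G])
    (nu : {measure set (borel G) -> \bar R}) (haar_nu : haar_measure nu)
    (Gamma : zmodClosed G) (discreteGamma : discrete (subgrp Gamma))
    (countableGamma : countable [set: subgrp Gamma])
    (indep_translates : forall f : G -> R[i], L2 nu setT f ->
      ~ ((f : borel G -> R[i]) = (fun=> 0) %[ae nu]) ->
      independent_translates Gamma nu f)
    (u : subgrp Gamma -> R[i])
    (u_l2 : (\esum_(a in [set: subgrp Gamma])
               (sqnorm (u a : R[i]^o))%:E < +oo)%E)
    (s : seq (subgrp Gamma)) (c : subgrp Gamma -> R[i]) (g : subgrp Gamma) :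
  uniq s -> (forall a, \sum_(b <- s) c b * u (a - b) = 0) ->
  g \in s -> c g != 0 -> forall a, u a = 0.
Proof.
move=> s_uniq cu0 gs cg a; apply/eqP; apply: contraT => ua0.
have [V [oV V0 [K [cK clK VK]] V_disj]] :=
  small_open_neighborhood locally_compactG discreteGamma.
have V_fin : (nu V < +oo)%E.
  apply: le_lt_trans (haar_compact haar_nu cK).
  by rewrite le_measure ?inE//; [exact: open_borel|exact: closed_borel].
suff : c g = 0 by move/eqP; rewrite (negPf cg).
pose f : G -> R[i] := spread V u.
apply: (indep_translates f) gs => //; first exact: spread_L2.
  (* On [V + a], which has positive measure, [f] takes the nonzero value [u a]. *)
  move=> [A [mA A0 fA]].
  have VA : translate V (sgval a) `<=` A.
    move=> x Vx; apply: fA => /= /(_ I).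
    by rewrite /f (spreadE V_disj u Vx) => /eqP; rewrite (negPf ua0).
  have : (0 < nu V)%E by apply: haar_open => //; exists 0.
  rewrite -(translate_measure haar_nu oV (sgval a)) -A0 ltNge.
  by rewrite le_measure ?inE//; exact: measurable_translate.
apply: aeW => x _.
(* On [V + b] the combination is the convolution at [b]; off all the translates every term is 0. *)
have [[b Vb]|nV] := pselect (exists b : subgrp Gamma, V (x - sgval b)).
  rewrite -[RHS](cu0 b); apply: eq_bigr => d _; congr (_ * _).
  apply: (spreadE V_disj); rewrite (sgvalB b d).
  by rewrite opprB addrA subrK.
apply: big1 => d _; rewrite /f spread0 ?mulr0// => b Vb; apply: nV.
by exists (d + b); rewrite (sgvalD d b) opprD addrA.
Qed.
(** * Affine systems *)

Section unitary_action.
Variables (R : realType) (H : completeNormedModType R[i]).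
Variable dot : {dot H for (@conjC R[i])}.
Variables (A : topologicalZmodType) (alpha : {additive A -> A}).
Variables (pi : A -> unitary dot) (delta : unitary dot) (psi : H).
Hypothesis rep_pi : unitary_representation pi.
Hypothesis delta_pi : forall g f, uinv delta (pi g (delta f)) = pi (alpha g) f.
Local Notation rdot := (rdot dot).
Local Notation coef2 := (coef2 dot).

Lemma uinv_dot (U : unitary dot) f g : dot (uinv U f) g = dot f (U g).
Proof. by rewrite -(uop_dot U) uinvK. Qed.

Lemma rep0 f : pi 0 f = f.
Proof. by apply: (can_inj (uopK (pi 0))); rewrite -rep_pi addr0. Qed.

Lemma repNK a f : pi a (pi (- a) f) = f.
Proof. by rewrite -rep_pi subrr rep0. Qed.

Lemma rep_dot a f g : dot (pi a f) g = dot f (pi (- a) g).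
Proof. by rewrite -(uop_dot (pi a) f) repNK. Qed.

Lemma upowS j f : upow delta (j + 1) f = delta (upow delta j f).
Proof.
case: j => [n|[|n]]; first by rewrite -PoszD addn1.
  by rewrite /= uinvK.
have -> : Negz n.+1 + 1 = Negz n.
  by rewrite !NegzE (intS n.+1) opprD addrAC addNr add0r.
by rewrite /= uinvK.
Qed.

Lemma upow_pred j f : upow delta (j - 1) f = uinv delta (upow delta j f).
Proof. by rewrite -[in RHS](subrK 1 j) upowS uopK. Qed.

Lemma upow_dot k j f g :
  dot (upow delta k f) (upow delta (j + k) g) = dot f (upow delta j g).
Proof.
elim/int_ind: k j f g => [|n IH|n IH] j f g; first by rewrite addr0.
  by rewrite intS [1 + _]addrC addrA !upowS uop_dot IH.
rewrite intS opprD [- 1 + _]addrC addrA !upow_pred uinv_dot uinvK.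
exact: IH.
Qed.

(** Moving [pi a] past one [delta] replaces [a] by [alpha a]; a negative power would call for an
    inverse of [alpha]. *)
Lemma upow_rep n a f : pi a (upow delta (Posz n) f) =
  upow delta (Posz n) (pi (iter n alpha a) f).
Proof.
elim: n a => //= n IH a.
rewrite (_ : pi a (delta _) = delta (pi (alpha a) (iter n delta f))).
  by rewrite (IH (alpha a)) -iterSr.
by rewrite -delta_pi uinvK.
Qed.

Definition affine (p : int * A) : H := upow delta p.1 (pi p.2 psi).

Lemma affine_dot k p f :
  dot (affine (p.1 + k, p.2)) (upow delta k f) = dot (affine p) f.
Proof. by rewrite dotC upow_dot -dotC. Qed.

Lemma affine_rep n a b :
  pi a (affine (Posz n, b)) = affine (Posz n, iter n alpha a + b).
Proof. by rewrite /affine upow_rep -rep_pi. Qed.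

Lemma affine_rdot p : rdot (affine p) (affine p) = rdot psi psi.
Proof.
have := upow_dot p.1 0 (pi p.2 psi) (pi p.2 psi).
by rewrite add0r /rdot /affine => ->; rewrite /= uop_dot.
Qed.

Lemma coef2_rep a f g : coef2 (pi a f) (pi a g) = coef2 f g.
Proof. by rewrite /coef2 uop_dot. Qed.

(** On a level [j >= 0], the unitary [pi a] permutes the affine vectors by [b |-> alpha^j a + b]. *)
Lemma reindex_levels (Q : set int) a f : (forall j, Q j -> 0 <= j) ->
  (\esum_(p in [set p : int * A | Q p.1]) (coef2 (pi a f) (affine p))%:E =
   \esum_(p in [set p : int * A | Q p.1]) (coef2 f (affine p))%:E)%E.
Proof.
move=> Q0; pose shift (p : int * A) := (p.1, iter `|p.1|%N alpha a + p.2).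
rewrite (reindex_esum [set p | Q p.1] [set p | Q p.1] shift).
  apply: eq_esum => -[j b] /= Qj; congr (_%:E).
  rewrite /shift /=; case: j Qj => [n|n /Q0//] _.
  by rewrite -affine_rep coef2_rep.
split=> [p //|[i b] [j c] _ _ [-> /addrI ->]//|[j b] /= Qj].
by exists (j, b - iter `|j|%N alpha a) => //; rewrite /shift /= addrC subrK.
Qed.


(** * Orthogonality to sets of levels *)

Definition ortho_levels (Q : set int) (f : H) :=
  forall p, Q p.1 -> dot (affine p) f = 0.

Lemma ortho_levels_rep (Q : set int) a f : (forall j, Q j -> 0 <= j) ->
  ortho_levels Q f -> ortho_levels Q (pi a f).
Proof.
move=> Q0 Qf [j b] /= Qj; rewrite -[a]opprK -rep_dot.
case: j Qj => [n|n /Q0//] Qj.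
by rewrite affine_rep; exact: Qf.
Qed.

Lemma ortho_levels_upow (Q Q' : set int) k f :
  (forall j, Q' (j + k) -> Q j) -> ortho_levels Q f ->
  ortho_levels Q' (upow delta k f).
Proof.
move=> QQ' Qf [j b] /= Q'j; have := affine_dot k (j - k, b) f.
by rewrite /= subrK => ->; apply: Qf; apply: QQ'; rewrite /= subrK.
Qed.

Hypothesis hilbertH : hilbert dot.
Hypothesis parseval :
  forall f, (\esum_(p in [set: int * A]) (coef2 f (affine p))%:E =
             (rdot f f)%:E)%E.
Hypothesis convolution_injective :
  forall u : A -> R[i],
    (\esum_(a in [set: A]) (sqnorm (u a : R[i]^o))%:E < +oo)%E ->
    forall (s : seq A) (c : A -> R[i]) g, uniq s ->
      (forall a, \sum_(b <- s) c b * u (a - b) = 0) ->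
      g \in s -> c g != 0 -> forall a, u a = 0.

Lemma bessel (D : set (int * A)) f :
  (\esum_(p in D) (coef2 f (affine p))%:E <= (rdot f f)%:E)%E.
Proof.
by rewrite -parseval esum_subset// => p; rewrite lee_fin coef2_ge0.
Qed.

Lemma esum_coef2_eq0 (D : set (int * A)) f :
  (\esum_(p in D) (coef2 f (affine p))%:E)%E = 0%E ->
  forall p, D p -> dot (affine p) f = 0.
Proof.
move=> D0 p Dp; rewrite dotC (_ : dot f _ = 0) ?rmorph0//.
apply/coef2_eq0/eqP; rewrite eq_le coef2_ge0 andbT.
suff : ((coef2 f (affine p))%:E <= 0)%E by rewrite lee_fin.
rewrite -D0; apply: esum_ge; exists [set p]; last by rewrite fsbig_set1.
by split=> [|_ ->//]; exact: finite_set1.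
Qed.

Lemma total_affine f : ortho_levels setT f -> f = 0.
Proof.
move=> f0; apply: (rdot_eq0 hilbertH); apply/eqP; rewrite -eqe -parseval.
rewrite esum1// => p _.
by rewrite /coef2 dotC f0// rmorph0 /sqnorm normr0 expr0n.
Qed.

(* The levels [j >= 0] together are invariant under [pi], hence by Parseval so
   is the part of the square norm carried by the levels [j < 0]. *)
Lemma ortho_neg_rep a f : ortho_levels [set j | j < 0] f ->
  ortho_levels [set j | j < 0] (pi a f).
Proof.
pose N : set (int * A) := [set p | p.1 < 0].
pose P : set (int * A) := [set p | 0 <= p.1].
have NP g : (\esum_(p in N) (coef2 g (affine p))%:E +
             \esum_(p in P) (coef2 g (affine p))%:E = (rdot g g)%:E)%E.
  rewrite -parseval (esumID N setT) => [|p _]; last first.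
    by rewrite lee_fin coef2_ge0.
  rewrite !setTI; congr (_ + esum _ _)%E.
  apply/seteqP; split=> p; rewrite /N /P /=.
    by rewrite leNgt => /negP.
  by rewrite leNgt => /negP.
move=> f0; have fN0 : (\esum_(p in N) (coef2 f (affine p))%:E = 0)%E.
  rewrite esum1// => p Np.
  by rewrite /coef2 dotC f0// rmorph0 /sqnorm normr0 expr0n.
have := NP (pi a f).
have -> : rdot (pi a f) (pi a f) = rdot f f by rewrite /rdot uop_dot.
rewrite -(NP f) fN0 add0e (reindex_levels a f (Q := [set j | 0 <= j]))// -/P.
move=> PE p; apply: (@esum_coef2_eq0 N).
move: PE; set x := esum P _; have xfin : x \is a fin_num.
  rewrite ge0_fin_numE; last first.
    by apply: esum_ge0 => q _; rewrite lee_fin coef2_ge0.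
  by apply: (le_lt_trans (bessel P f)); rewrite ltry.
by move=> PE; rewrite -[LHS](addeK _ xfin) PE subee.
Qed.

(** * Consequences of a linear relation *)

Section relation.
Variables (s : seq (int * A)) (c : int * A -> R[i]).
Hypotheses (s_uniq : uniq s) (sc0 : \sum_(p <- s) c p *: affine p = 0).

(** Pairing the relation with [delta^(p0.1) (pi a f)] kills the other levels and leaves a
    convolution of [u] with the coefficients at level [p0.1]. By Bessel [u] is square summable, so
    it vanishes. *)
Lemma relation_level p0 f : p0 \in s -> c p0 != 0 ->
  (forall a (p : int * A), p \in s -> c p != 0 -> p.1 != p0.1 ->
     dot (affine (p.1 - p0.1, p.2)) (pi a f) = 0) ->
  ortho_levels [set 0] f.
Proof.
move=> p0s cp0 f0; pose u a := dot psi (pi a f).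
have uE a : u a = dot (affine (0, - a)) f.
  by rewrite /u /affine /= rep_dot opprK.
suff u0 : forall a, u a = 0.
  by move=> [j b] /= ->; rewrite -[b]opprK -uE.
pose t := [seq p.2 | p <- s & p.1 == p0.1].
have t_uniq : uniq t.
  rewrite map_inj_in_uniq ?filter_uniq// => -[i a] [j b].
  by rewrite !mem_filter /= => /andP[/eqP -> _] /andP[/eqP -> _] ->.
apply: (convolution_injective _ (s := t) (c := fun g => c (p0.1, g))
  (g := p0.2)).
- apply: le_lt_trans (ltry (rdot f f)).
  apply: le_trans (bessel [set (0 : int, - a) | a in [set: A]] f).
  rewrite esum_image; last by move=> a b _ _ [/oppr_inj].
  apply: le_esum => a _; rewrite lee_fin uE /coef2 (dotC dot f) /sqnorm.
  by rewrite norm_conjC.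
- exact: t_uniq.
- move=> a; rewrite big_map big_filter /=.
  transitivity (\sum_(p <- s) c p * dot (affine (p.1 - p0.1, p.2)) (pi a f)).
    rewrite [RHS](bigID (fun p => p.1 == p0.1)) /=.
    rewrite [X in _ = _ + X]big1_seq ?addr0.
      apply: eq_bigr => -[j b] /= /eqP ->; congr (_ * _).
      by rewrite subrr /affine /= rep_dot -rep_pi addrC.
    move=> p /andP[p1 ps].
    have [->|cp] := eqVneq (c p) 0; first by rewrite mul0r.
    by rewrite f0 ?mulr0.
  transitivity (dot (\sum_(p <- s) c p *: affine p) (upow delta p0.1 (pi a f))).
    rewrite linear_sumlz; apply: eq_bigr => p _ /=.
    rewrite linearZl_LR /=; congr (_ * _).
    by rewrite -(affine_dot p0.1) /= subrK; case: p.
  by rewrite sc0 linear0l.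
- by apply/mapP; exists p0 => //; rewrite mem_filter eqxx.
- by case: p0 cp0 {p0s f0 t t_uniq}.
Qed.

(** At the top level of the relation, [relation_level] passes orthogonality from the levels below 0
    to level 0. Shifting by powers of [delta] reaches every level. *)
Lemma levels_lt0_total : (exists2 p : int * A, p \in s & c p != 0) ->
  forall f, ortho_levels [set j | j < 0] f -> f = 0.
Proof.
move=> [p1 p1s cp1].
have [p0 [p0s cp0 p0max]] : exists p0 : int * A, [/\ p0 \in s, c p0 != 0 &
    forall p : int * A, p \in s -> c p != 0 -> p.1 <= p0.1].
  have p1' : p1 \in [seq p <- s | c p != 0] by rewrite mem_filter cp1.
  have [p0] := seq_argmax fst p1'; rewrite mem_filter => /andP[cp0 p0s] p0max.
  by exists p0; split=> // p ps cp; apply: p0max; rewrite mem_filter cp.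
have step f : ortho_levels [set j | j < 0] f -> ortho_levels [set 0] f.
  move=> f0; apply: (relation_level p0s cp0) => a p ps cp pp0.
  apply: ortho_neg_rep => //=.
  by rewrite subr_lt0 lt_neqAle pp0 p0max.
move=> f f0; apply: total_affine => p _.
suff fn n : ortho_levels [set j | j < n%:Z] f.
  by apply: (fn `|p.1|.+1%N) => /=; lia.
elim: n => [//|n IH] [j b] /=; rewrite intS ltz1D.
rewrite le_eqVlt => /orP[/eqP ->|jn]; last exact: IH.
(* Level [n] of [f] is level 0 of [delta^(-n) f], to which [step] applies. *)
rewrite -(affine_dot (- n%:Z)) /= subrr.
apply: step; last by [].
by apply: ortho_levels_upow IH => i /=; lia.
Qed.

(** At the bottom level of a relation of width [J], orthogonality to levels 1 to [J] gives level 0.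
    Orthogonality to levels 0 to [J - 1] thus propagates to all negative levels, and
    [levels_lt0_total] concludes. *)
Lemma finite_levels_total : (exists2 p : int * A, p \in s & c p != 0) ->
  exists J : nat, forall f, ortho_levels [set j | 0 <= j < J%:Z] f -> f = 0.
Proof.
move=> cs.
have [p0 [J [p0s cp0 p0J]]] : exists (p0 : int * A) (J : nat),
    [/\ p0 \in s, c p0 != 0 &
    forall p : int * A, p \in s -> c p != 0 -> p0.1 <= p.1 <= p0.1 + J%:Z].
  have [p ps cp] := cs.
  have p' : p \in [seq p <- s | c p != 0] by rewrite mem_filter cp.
  have [p1 _ p1max] := seq_argmax fst p'.
  have [p0] := seq_argmax (fun p => - p.1) p'.
  rewrite mem_filter => /andP[cp0 p0s] p0min.
  exists p0, `|p1.1 - p0.1|%N; split=> // q qs cq.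
  have q' : q \in [seq p <- s | c p != 0] by rewrite mem_filter cq.
  by have := p0min q q'; have := p1max q q'; rewrite /=; lia.
have step f : ortho_levels [set j | 0 < j <= J%:Z] f -> ortho_levels [set 0] f.
  move=> f0; apply: (relation_level p0s cp0) => a p ps cp pp0.
  apply: (@ortho_levels_rep [set j | 0 < j <= J%:Z]) => //= [j /andP[/ltW]//|].
  by have := p0J p ps cp; move: pp0; rewrite /=; move: (p.1) (p0.1) => x y; lia.
exists J => f f0; apply: (levels_lt0_total cs).
suff fn n : ortho_levels [set j | - n%:Z <= j < J%:Z] f.
  by move=> p /= p0'; apply: (fn `|p.1|%N) => /=; lia.
elim: n => [|n IH]; first by rewrite oppr0.
move=> [j b] /= jJ; have [jn|nj] := leP (- n%:Z) j.
  by apply: IH => /=; lia.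
have -> : j = - (n.+1)%:Z by lia.
(* [delta^(n+1) f] is orthogonal to levels 1 to [J + n]; its level 0 is level [-(n+1)] of [f]. *)
rewrite -(affine_dot n.+1%:Z) /= addNr.
apply: step; last by [].
by apply: (@ortho_levels_upow _ _ n.+1%:Z _ _ IH) => i /=; lia.
Qed.

End relation.

(** * Finitely many orbits in finitely many levels *)

Hypothesis alpha_inj : injective alpha.
Hypothesis countable_affine : countable [set: int * A].
Hypothesis coset_reps : exists r : seq A, forall a,
  exists2 b, b \in r & exists a', a = alpha a' + b.

Lemma iter_coset_reps n : exists r : seq A, forall a,
  exists2 b, b \in r & exists a', a = iter n alpha a' + b.
Proof.
elim: n => [|n [r rP]].
  by exists [:: 0] => a; exists 0; rewrite ?mem_head//; exists a; rewrite addr0.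
have [r1 r1P] := coset_reps.
exists [seq alpha x + y | x <- r, y <- r1] => a.
have [y yr1 [a1 ->]] := r1P a; have [x xr [a2 ->]] := rP a1.
exists (alpha x + y); first by apply: allpairs_f.
by exists a2; rewrite raddfD addrA.
Qed.

(** The orbits of [pi] on level [j] correspond to the cosets of the image of [alpha^j], which has
    finite index. *)
Lemma level_reps (J : nat) : exists r : seq (int * A),
  [/\ uniq r, forall p, p \in r -> 0 <= p.1 < J%:Z &
      forall p : int * A, 0 <= p.1 < J%:Z -> exists2 q : int * A, q \in r &
        exists b, p = (q.1, iter `|q.1|%N alpha b + q.2)].
Proof.
elim: J => [|J [r [_ r_lt rP]]]; first by exists [::]; split=> // p /=; lia.
have [t tP] := iter_coset_reps J.
exists (undup (r ++ [seq (J%:Z, b) | b <- t])); split=> [|p|[j a] /= jJ].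
- exact: undup_uniq.
- rewrite mem_undup mem_cat => /orP[/r_lt|/mapP[b _ ->]] /=; lia.
have [/rP[q qr qE]|jJ'] := boolP (0 <= (j, a).1 < J%:Z).
  by exists q => //; rewrite mem_undup mem_cat qr.
have -> : j = J%:Z by move: jJ' => /=; lia.
have [b bt [a' ->]] := tP a.
exists (J%:Z, b); last by exists a'.
by rewrite mem_undup mem_cat map_f ?orbT.
Qed.

(** * The frame operator of finitely many levels and the trace estimate *)

Section finite_levels.
Variable J : nat.
Local Notation D := [set p : int * A | 0 <= p.1 < J%:Z].
Hypothesis D_total : forall f, ortho_levels [set j | 0 <= j < J%:Z] f -> f = 0.
Hypothesis psi_gt0 : 0 < rdot psi psi.

(** Conjugating [S] by [pi a] keeps its quadratic form, since the levels in [D] are only permuted;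
    polarization then gives commutation. *)
Lemma levels_operator : exists S : {linear H -> H},
  [/\ pos_contraction dot S, forall f, rdot (S f) f = 0 -> f = 0,
      forall f, (\esum_(p in D) (coef2 f (affine p))%:E = (rdot (S f) f)%:E)%E &
      forall a f, pi a (S f) = S (pi a f)].
Proof.
have [|S sS SE] := frame_operator hilbertH (D := D) (v := affine) _ (bessel D).
  exact: sub_countable (subset_card_le _) countable_affine.
exists S; split=> // [|f Sf0|a f].
- split=> // f.
    rewrite -lee_fin -SE; apply: esum_ge0 => p _.
    by rewrite lee_fin coef2_ge0.
  by rewrite -lee_fin -SE; exact: bessel.
- apply: D_total => p Dp.
  by apply: (@esum_coef2_eq0 D) => //; rewrite SE Sf0.
pose Y : {linear H -> H} := uop (pi (- a)) \o (S \o uop (pi a)).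
have YE g : Y g = pi (- a) (S (pi a g)) by [].
have Y_dot g k : rdot (Y g) k = rdot (S (pi a g)) (pi a k).
  by rewrite YE /rdot rep_dot opprK.
have sY : symmetric_op dot Y.
  by move=> g k; rewrite Y_dot [RHS]rdotC Y_dot sS rdotC.
have SY : Y =1 S.
  apply: (symmetric_op_eq hilbertH) => // g.
  apply/eqP; rewrite Y_dot -eqe -!SE; apply/eqP.
  by apply: (reindex_levels (Q := [set j | 0 <= j < J%:Z])) => j /andP[].
by rewrite -SY YE repNK.
Qed.

(** The sum of [|<t (h k), affine p>|^2] over [k < K] and [p] in [D] is estimated twice: each [k]
    contributes at least [|psi|^2 / 2], and each orbit representative [q] at most 1. *)
Lemma trace_bound : exists m : nat, forall K : nat,
  K%:R * (rdot psi psi / 2) <= m%:R :> R.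
Proof.
have [S [pcS S_inj SE piS]] := levels_operator.
have [r [r_uniq rD rP]] := level_reps J.
exists (size r) => K.
pose h (k : nat) := affine (k%:Z, 0).
(* The allowed error is half the squared norm shared by all [h k]. *)
have [t [ft t1 th]] := inverse_sqrt hilbertH pcS S_inj
  [seq h k | k <- iota 0 K] (divr_gt0 psi_gt0 (ltr0n _ 2)).
have tdot := symmetric_op_dot (ft.1).
have tpi a f : t (pi a f) = pi a (t f).
  by rewrite (ft.2 (uop (pi a)))// => g; rewrite piS.
(* [w p] consists of an orbit representative and a group element carrying it to [p]. *)
have [w wP] : exists w : int * A -> (int * A) * A, forall p, D p ->
    [/\ (w p).1 \in r &
      p = ((w p).1.1, iter `|(w p).1.1|%N alpha (w p).2 + (w p).1.2)].
  have /choice [w wP] : forall p : int * A, exists qb : (int * A) * A, D p ->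
      qb.1 \in r /\ p = (qb.1.1, iter `|qb.1.1|%N alpha qb.2 + qb.1.2).
    move=> p; have [Dp|nD] := pselect (D p); last by exists (p, 0).
    by have [q qr [b pE]] := rP p Dp; exists (q, b).
  by exists w => p /wP [].
have affineE p : D p -> affine p = pi (w p).2 (affine (w p).1).
  move=> Dp; have [wr pE] := wP p Dp; rewrite [in LHS]pE.
  have := rD _ wr; case: ((w p).1) => [[n|//] b] /= _.
  by rewrite affine_rep.
(* Moving [t] and [pi] across the inner product exchanges the roles of [h k] and the
   representative. *)
have coefE (k : nat) p : D p -> coef2 (t (h k)) (affine p) =
    coef2 (t (affine (w p).1)) (affine (k%:Z, iter k alpha (- (w p).2))).
  move=> Dp; rewrite affineE// -[(w p).2]opprK.
  rewrite -(coef2_rep (- (w p).2)) repNK opprK -tpi /h affine_rep addr0.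
  by rewrite coef2C /coef2 -tdot.
(* Keeping only the term at [q] in the form of [S] at [t g] gives
   [|g|^4 <= <S (t g), t g> <= |g|^2]. *)
have tg_le1 q : q \in r -> rdot (t (affine q)) (t (affine q)) <= 1.
  move=> qr; set g := t (affine q).
  have : coef2 (t g) (affine q) <= rdot g g.
    apply: le_trans (t1 g); rewrite -lee_fin -SE; apply: esum_ge.
    exists [set q]; last by rewrite fsbig_set1.
    by split=> [|_ -> /=]; [exact: finite_set1|exact: rD].
  have -> : coef2 (t g) (affine q) = rdot g g ^+ 2.
    by rewrite /coef2 tdot -/(coef2 g g) coef2ff.
  have [->|g0] := eqVneq (rdot g g) 0; first by rewrite ler01.
  have g_gt0 : 0 < rdot g g by rewrite lt_neqAle eq_sym g0 (rdot_ge0 hilbertH).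
  by rewrite expr2 -[leRHS]mulr1 ler_pM2l.
pose c q y := (coef2 (t (affine q)) (affine y))%:E.
have c_ge0 q y : (0 <= c q y)%E by rewrite lee_fin coef2_ge0.
pose tau (k : nat) p := (k%:Z, iter k alpha (- (w p).2)).
have hE k : (\esum_(p in D) (coef2 (t (h k)) (affine p))%:E =
    \sum_(q <- r) \esum_(p in D) if (w p).1 == q then c q (tau k p) else 0)%E.
  rewrite -esum_sum; last by move=> p q _ _; case: ifP.
  apply: eq_esum => p Dp; have [wr _] := wP p Dp.
  rewrite (bigD1_seq (w p).1)//= eqxx big1 ?adde0; first by rewrite coefE.
  by move=> q /negPf wq; rewrite eq_sym wq.
have iter_inj k : injective (iter k alpha).
  by elim: k => [//|k IH] a b /= /alpha_inj /IH.
have c_le (k : nat) q : q \in r ->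
  (\esum_(p in D) (if (w p).1 == q then c q (tau k p) else 0) <=
   \esum_(y in [set: int * A]) if y.1 == k%:Z then c q y else 0)%E.
  move=> qr; pose B := [set p | (w p).1 == q].
  rewrite (_ : (\esum_(p in D) _ =
                \esum_(p in D `&` B) c q (tau k p))%E); last first.
    rewrite esum_mkcondr; apply: eq_esum => p _.
    rewrite (_ : (p \in B) = ((w p).1 == q))//.
    by apply/idP/idP => [/set_mem|/mem_set].
  (* Within one orbit, [tau k] is injective because [alpha] is, and it lands in level [k]. *)
  rewrite -(esum_image _ (tau k)); last first.
    move=> p p' /set_mem [Dp /= /eqP wp] /set_mem [Dp' /= /eqP wp'].
    move=> [/iter_inj /oppr_inj ww].
    by rewrite (wP p Dp).2 (wP p' Dp').2 wp wp' ww.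
  apply: (@le_trans _ _ (\esum_(y in [set y : int * A | y.1 == k%:Z]) c q y)%E).
    by apply: esum_subset => // _ [p _ <-] /=.
  rewrite esum_mkcond; apply: le_esum => y _.
  rewrite (_ : (y \in _) = (y.1 == k%:Z))//.
  by apply/idP/idP => [/set_mem|yk]; last exact: mem_set.
have sum_c_le q : q \in r ->
  (\sum_(k <- iota 0 K)
     \esum_(p in D) (if (w p).1 == q then c q (tau k p) else 0) <=
   1%:E)%E.
  move=> qr.
  apply: (@le_trans _ _ (rdot (t (affine q)) (t (affine q)))%:E); last first.
    by rewrite lee_fin tg_le1.
  (* Distinct [k] give disjoint levels, so Parseval for [t (affine q)] bounds all of them
     together. *)
  rewrite -parseval; apply: (le_trans (lee_sum _ (fun k _ => c_le k q qr))).
  rewrite -esum_sum; last by move=> y k _ _; case: ifP.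
  apply: le_esum => -[y b] _ /=.
  have [[n yn nK]|nK] := pselect (exists2 n : nat, y = n%:Z & n \in iota 0 K).
    rewrite (bigD1_seq n) ?iota_uniq//= yn eqxx big1 ?adde0//.
    by move=> k kn; rewrite eqz_nat eq_sym (negPf kn).
  rewrite big1_seq ?lee_fin ?coef2_ge0// => k /andP[_ kK].
  case: ifPn => // /eqP yk.
  by case: nK; exists k.
rewrite -lee_fin.
apply: (@le_trans _ _ (\sum_(k <- iota 0 K)
    \esum_(p in D) (coef2 (t (h k)) (affine p))%:E)%E).
  rewrite (_ : K%:R * _ = \sum_(k <- iota 0 K) rdot psi psi / 2); last first.
    by rewrite big_const_seq count_predT size_iota iter_addr_0 mulr_natl.
  rewrite -sumEFin !big_seq; apply: lee_sum => k kK.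
  rewrite SE lee_fin; have := th (h k) (map_f h kK).
  by rewrite /h affine_rdot; lra.
under eq_bigr do rewrite hE.
rewrite exchange_big /=.
apply: (@le_trans _ _ (\sum_(q <- r) 1%:E)%E).
  by rewrite !big_seq; apply: lee_sum => q qr; exact: sum_c_le.
by rewrite sumEFin big_const_seq count_predT iter_addr_0.
Qed.

End finite_levels.

End unitary_action.

(** * Coset representatives and conclusion *)

Lemma finite_coset_reps (A : zmodType) (alpha : {additive A -> A}) (N : nat) :
  ([set [set x + alpha y | y in [set: A]] | x in [set: A]] #= `I_N)%card ->
  exists r : seq A, forall a,
    exists2 b, b \in r & exists a', a = alpha a' + b.
Proof.
move=> cosetsN; set F := [set _ | _ in _] in cosetsN.
have /finite_seqP [s Fs] : finite_set F by exists N.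
have /choice [rho rhoP] : forall C : set A, exists x, F C ->
    C = [set x + alpha y | y in [set: A]].
  move=> C; have [[x _ <-]|nC] := pselect (F C); first by exists x.
  by exists 0.
exists [seq rho C | C <- s] => a.
pose C := [set a + alpha y | y in [set: A]].
have FC : F C by exists a.
exists (rho C); first by apply: map_f; move: FC; rewrite Fs.
have : C a by exists 0 => //; rewrite raddf0 addr0.
by rewrite {1}(rhoP C FC) => -[y _ <-]; exists y; rewrite addrC.
Qed.

Theorem theorem2 (R : realType) (G : topologicalZmodType)
    (second_countableG : @second_countable G)
    (locally_compactG : locally_compact [set: G])
    (hausdorffG : hausdorff_space G)
    (nu : {measure set (borel G) -> \bar R}) (haar_nu : haar_measure nu)
    (Gamma : zmodClosed G)
    (closedGamma : closed [set x : G | x \in Gamma])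
    (countableGamma : countable [set x : G | x \in Gamma])
    (discreteGamma : discrete (subgrp Gamma))
    (lambda : probability (borel (dual R (subgrp Gamma))) R)
    (haar_lambda : haar_measure lambda)
    (alpha : {additive subgrp Gamma -> subgrp Gamma}) (inj_alpha : injective alpha)
    (N : nat) (N_gt1 : (1 < N)%N)
    (index_alpha : ([set [set x + alpha y | y in [set: subgrp Gamma]]
                      | x in [set: subgrp Gamma]] #= `I_N)%card)
    (ergodic_alpha : ergodic lambda
      (dual_map (discrete_continuous (f := alpha) discreteGamma)))
    (H : completeNormedModType R[i]) (dot : {dot H for (@conjC R[i])})
    (hilbertH : hilbert dot) (separableH : separable H)
    (pi : subgrp Gamma -> unitary dot) (rep_pi : unitary_representation pi)
    (mu : {finite_measure set (borel (dual R (subgrp Gamma))) -> \bar R})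
    (spectral_mu : spectral_measure pi mu) (ac_mu : mu `<< lambda)
    (delta : unitary dot)
    (delta_pi : forall g f, uinv delta (pi g (delta f)) = pi (alpha g) f)
    (indep_translates : forall f : G -> R[i], L2 nu setT f ->
      ~ ((f : borel G -> R[i]) = (fun=> 0) %[ae nu]) ->
      independent_translates Gamma nu f)
    (psi : H) (psi_neq0 : psi != 0) :
  let affine (p : int * subgrp Gamma) : H := upow delta p.1 (pi p.2 psi) in
  parseval_frame dot affine -> independent affine.
Proof.
move=> aff [countable_index parseval] s c s_uniq sc0 p ps.
apply/eqP; apply: contraT => cp.
have parseval' f : (\esum_(q in [set: int * subgrp Gamma])
    (coef2 dot f (affine pi delta psi q))%:E = (rdot dot f f)%:E)%E.
  by rewrite -(sqnormE hilbertH); exact: parseval.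
have countable_subgrp : countable [set: subgrp Gamma].
  have /countable_injP [e e_inj] := countable_index.
  apply/countable_injP; exists (fun a => e (0, a)) => a b _ _.
  by move=> /e_inj; rewrite !inE => /(_ I I) [].
have conv := l2_convolution_injective locally_compactG haar_nu discreteGamma
  countable_subgrp indep_translates.
have psi_gt0 : 0 < rdot dot psi psi.
  rewrite lt_neqAle (rdot_ge0 hilbertH) andbT eq_sym; apply: contra psi_neq0.
  by move=> /eqP /(rdot_eq0 hilbertH) ->.
have [J J_total] := finite_levels_total rep_pi delta_pi hilbertH parseval' conv
  s_uniq sc0 (ex_intro2 _ _ p ps cp).
have [m mP] := trace_bound rep_pi delta_pi hilbertH parseval' inj_alpha
  countable_index (finite_coset_reps index_alpha) J_total psi_gt0.
set d := rdot dot psi psi / 2 in mP.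
have d_gt0 : 0 < d by rewrite divr_gt0.
(* A natural number [K] beyond [m / d] contradicts the trace bound. *)
have : 0 <= m%:R / d by rewrite divr_ge0// ltW.
move=> /archi_boundP; rewrite ltr_pdivrMr// => mK.
by have := lt_le_trans mK (mP _); rewrite ltxx.
Qed.
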